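(* Let $n\ge 3$ and let $D$ be a $\mathrm{Gr}(3,n)$ tree web, i.e. an $\mathrm{SL}_3$ tensor diagram with $n$ boundary vertices, all black, which is an $\mathrm{SL}_3$ tree web. Then its invariant $[D]\in\mathbb{C}[\widehat{\mathrm{Gr}}(3,n)]$ is a cluster variable or a coefficient (frozen) variable of the cluster algebra $\mathbb{C}[\widehat{\mathrm{Gr}}(3,n)]$.
   Context: **Grassmannian.** $\mathbb{C}[\widehat{\mathrm{Gr}}(k,n)]$ is the homogeneous coordinate ring of the Grassmannian of $k$-planes in $\mathbb{C}^n$, generated by the Plücker coordinates $P_{j_1,\dots,j_k}=\det(v_{j_1},\dots,v_{j_k})$ of a $k\times n$ matrix with columns $v_1,\dots,v_n$. It is identified with the ring of $\mathrm{SL}_k$-invariant polynomials in $n$ vectors $v_1,\dots,v_n\in V=\mathbb{C}^k$. **Cluster structure.** A seed is a pair $(\widetilde{\mathbf x},Q)$ of a free generating set of the ambient field and a quiver without loops or 2-cycles whose vertices are indexed by $\widetilde{\mathbf x}$ and divided into mutable and frozen ones. Mutation at a mutable vertex $m$ replaces $x_m$ by $x_m'$ with $x_mx_m'=\prod_{m\to j}x_j+\prod_{j\to m}x_j$ (products over arrows), and mutates the quiver: for each $i\to m\to j$ add an arrow $i\to j$; reverse all arrows at $m$; remove a maximal set of disjoint 2-cycles. For $n>k$ the cluster structure on $\mathbb{C}[\widehat{\mathrm{Gr}}(k,n)]$ is given by the rectangles seed $\Sigma_{k,n}$. Its quiver has vertices $\varnothing$ and $(i,j)$ for $1\le i\le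 k$, $1\le j\le n-k$. The variable at $(i,j)$ is $P_J$ with $J=\{n-k-j+1,\dots,n-k-j+i\}\cup\{n-k+i+1,\dots,n\}$, and the variable at $\varnothing$ is $P_{\{n-k+1,\dots,n\}}$. There are arrows $(i,j)\to(i,j+1)$, $(i,j)\to(i+1,j)$, $(i,j)\to(i-1,j-1)$ whenever both ends exist and are not both frozen, and an arrow $\varnothing\to(1,1)$. The frozen vertices are $\varnothing$ and the $(i,j)$ with $i=k$ or $j=n-k$. The frozen (coefficient) variables are thus the cyclically consecutive Plücker coordinates $P_{\{i,i+1,\dots,i+k-1\}\bmod n}$ (indices written in increasing order). Cluster variables are all mutable variables in seeds obtained from $\Sigma_{k,n}$ by finite sequences of mutations. For $n=k$ the only variable is the frozen variable $P_{1,\dots,k}$. **$\mathrm{SL}_3$ webs.** An $\mathrm{SL}_3$ tensor diagram is a finite bipartite (black/white) graph drawn in a disk, with vertices partitioned into boundary vertices (on the boundary circle, labeled clockwise) and internal vertices (inside the disk); each internal vertex is trivalent, with a fixed cyclic order on its incident edges. It is a web if the drawing is planar (with the clockwise cyclic order at each internal vertex). A diagram for $\mathrm{Gr}(3,n)$ has $n$ boundary vertices, all black, with boundary vertex $i$ carrying the vector $v_i$. An $\mathrm{SL}_3$ tree web is an $\mathrm{SL}_3$ web whose underlying graph is connected without cycles and all of whose boundary vertices have degree 1. **The invariant $[D]$ of a tree web.** Let $V=\mathbb{C}^3$. Choose any internal vertex as root, orient all edges toward it, and read edges at each vertex in clockwise order with the outgoing edge last. A boundary vertex $i$ outputs $v_i$.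 A non-root white vertex with incoming vectors $v,w$ outputs the covector $v\times w=\det(v,w,-)$. A non-root internal black vertex with incoming covectors $c_1,c_2$ outputs the vector $b(c_1,c_2)=\det^*(c_1,c_2,-)\in V$, where $\det^*$ is the dual volume form on $V^*$ ($\det^*(e_1^*,e_2^*,e_3^* )=1$ for the basis dual to the standard one). A root which is white (resp. black) evaluates $\det$ (resp. $\det^*$) on its three incoming vectors (resp. covectors). The result $[D]$ does not depend on the choice of root. *)

(* Defs.v *)
From HB Require Import structures.
From mathcomp Require Import all_boot all_order all_algebra.
From mathcomp Require Import perm.
From mathcomp Require Export reals complex mpoly.

Set Implicit Arguments.
Unset Strict Implicit.
Unset Printing Implicit Defensive.

Import GRing.Theory.
Local Open Scope ring_scope.

(** * The homogeneous coordinate ring of the Grassmannian *)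

Section Grassmannian.
Variables (K : fieldType) (k n : nat).

(* The ring of polynomials in the entries of a k x n matrix; its fraction
   field contains the fraction field of the coordinate ring. *)
Definition matrix_poly := {mpoly K[k * n]}.
Definition matrix_frac := {fraction matrix_poly}.

Definition generic_matrix : 'M[matrix_poly]_(k, n) :=
  \matrix_(a, c) 'X_(mxvec_index a c).

(* Meaningful when #|J| = k.  [enum J] is increasing, so the columns are
   taken in increasing order. *)
Definition plucker (J : {set 'I_n}) : matrix_poly :=
  \det (\matrix_(a < k, p < k) [seq generic_matrix a c | c <- enum J]`_p).

Inductive in_coordinate_ring : matrix_poly -> Prop :=
| Coord_const (c : K) : in_coordinate_ring c%:MP
| Coord_plucker (J : {set 'I_n}) : #|J| = k -> in_coordinate_ring (plucker J)
| Coord_add (f g : matrix_poly) :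
    in_coordinate_ring f -> in_coordinate_ring g -> in_coordinate_ring (f + g)
| Coord_mul (f g : matrix_poly) :
    in_coordinate_ring f -> in_coordinate_ring g -> in_coordinate_ring (f * g).

End Grassmannian.

(** * Seeds and mutations *)

(* [arrows u v] is the number of arrows u -> v. *)
Record seed (F : fieldType) (Q : finType) := Seed {
  variable : Q -> F;
  arrows : Q -> Q -> nat;
  frozen : pred Q
}.

Section Mutation.
Variables (F : fieldType) (Q : finType).
Implicit Types (S : seed F Q) (m u v : Q).

Definition mutate_variable S m v : F :=
  if v == m then
    (\prod_(u : Q) variable S u ^+ arrows S m u
     + \prod_(u : Q) variable S u ^+ arrows S u m) / variable S m
  else variable S v.

(* Before the removal of 2-cycles. *)
Definition premutate_arrows S m u v : nat :=
  if (u == m) || (v == m) then arrows S v u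
  else (arrows S u v + arrows S u m * arrows S m v)%N.

(* Truncated subtraction cancels a maximal set of disjoint 2-cycles. *)
Definition mutate_arrows S m u v : nat :=
  (premutate_arrows S m u v - premutate_arrows S m v u)%N.

Definition mutate S m : seed F Q :=
  Seed (mutate_variable S m) (mutate_arrows S m) (frozen S).

Inductive mutation_equivalent (S0 : seed F Q) : seed F Q -> Prop :=
| Mut_refl : mutation_equivalent S0 S0
| Mut_step S m : mutation_equivalent S0 S -> ~~ frozen S m ->
    mutation_equivalent S0 (mutate S m).

Definition cluster_variable (S0 : seed F Q) (z : F) : Prop :=
  exists S m, [/\ mutation_equivalent S0 S, ~~ frozen S m & z = variable S m].

Definition frozen_variable (S0 : seed F Q) (z : F) : Prop :=
  exists2 v, frozen S0 v & z = variable S0 v.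

End Mutation.

(** * The rectangles seed *)

Section RectanglesSeed.
Variables (K : fieldType) (k n : nat).

(* [None] is the vertex written as the empty set; [Some (i, j)] is the vertex
   with 1-based coordinates (i.+1, j.+1).  Columns are numbered from 0 too,
   so every interval of columns below is shifted by one.  For n = k only
   [None] remains. *)
Definition rect_vertex : finType := option ('I_k * 'I_(n - k)).

Definition rect_columns (u : rect_vertex) : {set 'I_n} :=
  match u with
  | None => [set c : 'I_n | n - k <= c]%N
  | Some (i, j) =>
      [set c : 'I_n | n - k - j.+1 <= c < n - k - j.+1 + i.+1]%N
      :|: [set c : 'I_n | n - k + i.+1 <= c]%N
  end.

Definition rect_frozen (u : rect_vertex) : bool :=
  match u with
  | None => true
  | Some (i, j) => (i.+1 == k) || (j.+1 == n - k)%N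
  end.

Definition rect_arrow (u v : rect_vertex) : bool :=
  match u, v with
  | Some (i, j), Some (i', j') =>
      ~~ (rect_frozen u && rect_frozen v)
      && [|| (i' == i :> nat) && (j' == j.+1 :> nat),
             (i' == i.+1 :> nat) && (j' == j :> nat)
           | (i == i'.+1 :> nat) && (j == j'.+1 :> nat)]
  | None, Some (i, j) => (i == 0 :> nat)%N && (j == 0 :> nat)%N
  | _, None => false
  end.

Definition rectangles_seed : seed (matrix_frac K k n) rect_vertex :=
  Seed (fun u => tofrac (plucker K k (rect_columns u)))
       (fun u v => nat_of_bool (rect_arrow u v))
       rect_frozen.

End RectanglesSeed.

(** * SL_3 tensor diagrams *)

(* A drawing in the disk is encoded by its rotation system: multiple edges
   are allowed, a half-edge (e, true) is the end of e at its white vertex and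
   (e, false) the end at its black vertex.  The boundary circle is recorded
   as well: the arc of circle running clockwise from boundary vertex i to the
   next one has the two ends [inr (i, true)], at i, and
   [inr (ordS i, false)], at the next boundary vertex. *)
Definition diagram_dart (n : nat) (E : finType) : finType :=
  ((E * bool) + ('I_n * bool))%type.

Definition half_edge_vertex (V E : finType) (bend wend : E -> V)
    (h : E * bool) : V :=
  if h.2 then wend h.1 else bend h.1.

Definition dart_vertex n (I E : finType) (bend wend : E -> 'I_n + I)
    (x : diagram_dart n E) : 'I_n + I :=
  match x with
  | inl h => half_edge_vertex bend wend h
  | inr (i, _) => inl i
  end.

(* [rotation x] is the dart following x clockwise around their common vertex.
   At a boundary vertex nothing is drawn outside of the disk, hence the arc
   coming from the previous boundary vertex is followed by the arc leading to
   the next one. *)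
Record tensor_diagram (n : nat) := TensorDiagram {
  internal : finType;
  edge : finType;
  is_white : 'I_n + internal -> bool;
  black_end : edge -> 'I_n + internal;
  white_end : edge -> 'I_n + internal;
  rotation : {perm diagram_dart n edge};
  black_endP : forall e, ~~ is_white (black_end e);
  white_endP : forall e, is_white (white_end e);
  trivalentP : forall v : internal,
    #|[set h | half_edge_vertex black_end white_end h == inr v]| = 3%N;
  rotationP : forall x y,
    (y \in porbit rotation x)
    = (dart_vertex black_end white_end x == dart_vertex black_end white_end y);
  boundaryP : forall i : 'I_n, rotation (inr (i, false)) = inr (i, true)
}.

Section TensorDiagram.
Variables (n : nat) (D : tensor_diagram n).

Definition vertex : finType := ('I_n + internal D)%type.
Definition dart : finType := diagram_dart n (edge D).

Definition vertex_of : dart -> vertex :=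
  dart_vertex (@black_end n D) (@white_end n D).

Definition opposite (x : dart) : dart :=
  match x with
  | inl (e, b) => inl (e, ~~ b)
  | inr (i, true) => inr (ordS i, false)
  | inr (i, false) => inr (ord_pred i, true)
  end.

Definition next_in_face (x : dart) : dart := rotation D (opposite x).

Definition linked : rel vertex :=
  [rel u v | [exists x : dart, (vertex_of x == u) && (vertex_of (opposite x) == v)]].

(* Euler's formula, for the drawing together with the boundary circle. *)
Definition planar : Prop :=
  (#|vertex| + fcard next_in_face dart = #|edge D| + n + 2 * n_comp linked vertex)%N.

Definition half_edge_at (h : edge D * bool) : vertex := vertex_of (inl h).

Definition degree (v : vertex) : nat := #|[set h | half_edge_at h == v]|.

Definition adjacent : rel vertex :=
  [rel u v | [exists h, (half_edge_at h == u) && (half_edge_at (h.1, ~~ h.2) == v)]].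

Definition connected : Prop := forall u v : vertex, connect adjacent u v.

(* A half-edge stands for its edge traversed from that end. *)
Definition graph_cycle (c : seq (edge D * bool)) : bool :=
  [&& c != [::],
      path.cycle (fun h h' => half_edge_at (h.1, ~~ h.2) == half_edge_at h') c,
      uniq [seq half_edge_at h | h <- c]
    & uniq [seq h.1 | h <- c]].

Definition tree_web : Prop :=
  [/\ planar,
      connected,
      (forall c, ~~ graph_cycle c)
    & forall i : 'I_n, degree (inl i) = 1%N].

Definition black_boundary : Prop := forall i : 'I_n, ~~ is_white (inl i : vertex).

End TensorDiagram.

Definition Gr3_tree_web n (D : tensor_diagram n) : Prop :=
  black_boundary D /\ tree_web D.

(** * The invariant of a tree web *)

(* Vectors and covectors are both given by rows of coordinates, in the
   standard basis and in its dual, so [volume] is det on vectors and det* on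
   covectors. *)
Definition volume (A : comPzRingType) (u v w : 'rV[A]_3) : A :=
  \det (\matrix_(i < 3) [:: u; v; w]`_i).

(* The form volume(u, v, -) in the dual coordinates: both the covector
   det(u, v, -) and the vector det*(u, v, -). *)
Definition cross (A : comPzRingType) (u v : 'rV[A]_3) : 'rV[A]_3 :=
  \row_j volume u v (delta_mx 0 j).

Section Invariant.
Variables (K : fieldType) (n : nat) (D : tensor_diagram n).

(* [output d x] is what the vertex at x sends along the edge of x oriented
   away from that vertex, computed by a recursion of depth at most d.  In a
   tree the recursion follows paths with distinct vertices, so d = number of
   vertices is always enough. *)
Fixpoint output (d : nat) (x : dart D) : 'rV[matrix_poly K 3 n]_3 :=
  if d is d'.+1 then
    match vertex_of x with
    | inl i => (col i (generic_matrix K 3 n))^T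
    | inr _ =>
        let y := rotation D x in
        let z := rotation D y in
        cross (output d' (opposite y)) (output d' (opposite z))
    end
  else 0.

(* The inputs of the root r are read clockwise; where one starts is
   irrelevant since [volume] is invariant under cyclic permutations. *)
Definition web_invariant (r : internal D) : matrix_poly K 3 n :=
  let inp x := output #|vertex D| (opposite x) in
  if [pick x : dart D | vertex_of x == inr r] is Some x then
    volume (inp x) (inp (rotation D x)) (inp (rotation D (rotation D x)))
  else 0.

End Invariant.

(* Main.v *)
From HB Require Import structures.
Require Import Defs.
From mathcomp Require Import all_boot all_order all_fingroup all_algebra.
From mathcomp Require Import ring zify.

Set Implicit Arguments.
Unset Strict Implicit.
Unset Printing Implicit Defensive.

(* A web with black boundary is the volume of three trees of vectors, each of
   them a column or (a x b) x (c x d) for smaller trees.  Cut off a node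
   (v_1 x v_2) x (v_3 x v_4), which is at the columns 1 to 4 after a rotation
   of the columns.  The web is then the image of a smaller one under the
   substitution that sends the first column to this vector and shifts the
   others by 3.  Four mutations of the rectangles seed of Gr(3,n) produce a
   seed which contains the image of the rectangles seed of Gr(3,n-3), with no
   arrow from its mutable part to the other vertices, hence the substitution
   maps cluster variables to cluster variables.  Rotations do so too, since
   mutating the first row of the rectangles seed and then the second one
   gives its image under the rotation.

   That a tree web has this form follows from Euler's formula: there are n
   faces inside of the circle, every face meets the circle because a face walk
   never backtracks at a trivalent vertex, so that every face meets it in
   exactly one arc, and consecutive leaves have consecutive labels. *)

(** * Reduced walks in the diagram *)

(** Seeds live in fraction fields while the substitutions act on polynomials, so carrying a mutation
    across needs the image of the variable divided by to be nonzero. Positivity supplies this: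
    mutations use no subtraction, and all variables of the rectangles seed are positive at points of
    the moment curve. Mutations can create arrows between frozen vertices, which have no counterpart
    in the rectangles quiver; seeds are therefore compared only along arrows with a mutable end.
    Every vector tree has 1 mod 3 leaves, so [n] is divisible by 3 and the induction goes from
    [n - 3] to [n]. The four mutations need room for [n >= 9]; at [n = 6] the smaller seed is a
    single frozen variable and the first mutation is enough. On the side of the diagram, comparing
    faces gives leaf labels only modulo [n]. That the leaves go around the circle exactly once comes
    from the uniqueness of reduced walks in a tree. *)

Section Walks.
Variables (n : nat) (D : tensor_diagram n).
Local Notation H := (edge D * bool)%type.
Local Notation hv := (@half_edge_at n D).
Implicit Types (h : H) (p q c : seq H).

Definition flip h : H := (h.1, ~~ h.2).

Lemma flipK : involutive flip.
Proof. by case=> e b; rewrite /flip /= negbK. Qed.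

Definition reduced h h' : bool := (hv (flip h) == hv h') && (h' != flip h).

Lemma reduced_flip h h' : reduced (flip h') (flip h) = reduced h h'.
Proof. by rewrite /reduced !flipK eq_sym [flip h == _]eq_sym. Qed.

Definition walk_end h p : vertex D := hv (flip (last h p)).

Lemma reverse_path h p h' p' : path reduced h p -> reduced (flip h) h' ->
  path reduced h' p' -> path reduced (flip (last h p)) (map flip (rev (belast h p)) ++ h' :: p').
Proof.
move=> hp hh' hp'; have El : last (last h p) (rev (belast h p)) = h.
  by case: p {hp} => //= a p; rewrite rev_cons last_rcons.
rewrite cat_path last_map El /= hh' hp' /= andbT path_map rev_path.
by apply: sub_path hp => a b /=; rewrite reduced_flip.
Qed.

Lemma walk_junction h h' : hv h = hv h' -> h != h' -> reduced (flip h) h'.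
Proof. by move=> E nh; rewrite /reduced flipK E eqxx eq_sym. Qed.

Hypothesis acyclic : forall c, ~~ @graph_cycle n D c.

Lemma closed_walk h p : path reduced h p -> uniq (map hv (h :: p)) ->
  walk_end h p != hv h.
Proof.
move=> hp un; apply/negP => /eqP E; case/negP: (acyclic (h :: p)); apply/and4P; split=> //.
  rewrite /= rcons_path; apply/andP; split; last by rewrite -E.
  by apply: sub_path hp => a b /andP[].
(* No edge is used twice: in the same direction the starting vertices would agree; in opposite
   directions the second use would start where step [i.+1] does, hence be that step, which is a
   backtrack. *)
apply/(uniqP (h.1)) => i j; rewrite !inE size_map => li lj.
wlog ij : i j li lj / i <= j.
  by move=> W E'; case: (leqP i j) => [/W|/ltnW/W W']; [apply|apply/esym/W'].
rewrite !(nth_map h) // => Eij; apply/eqP; rewrite eqn_leq ij /= leqNgt; apply/negP => {}ij.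
set c := h :: p in li lj Eij un.
have Enth k : k.+1 < size c -> reduced (nth h c k) (nth h c k.+1).
  by move=> lk; move/(pathP h): hp; apply.
have inj k l : k < size c -> l < size c -> hv (nth h c k) = hv (nth h c l) -> k = l.
  move=> lk ll Ekl; apply/eqP; rewrite -(nth_uniq (hv h) _ _ un) ?size_map //.
  by rewrite !(nth_map h) // Ekl.
have {}Enth := Enth i (leq_ltn_trans ij lj).
have [Eb|Eb] := eqVneq (nth h c i).2 (nth h c j).2.
  have Eh : nth h c i = nth h c j.
    by move: Eij Eb; case: (nth h c i) => e b; case: (nth h c j) => e' b' /= -> ->.
  by have := inj i j li lj; rewrite Eh => /(_ erefl) E'; rewrite E' ltnn in ij.
have Eh : nth h c j = flip (nth h c i).
  move: Eij Eb; case: (nth h c i) => e b; case: (nth h c j) => e' b' /= ->.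
  by rewrite /flip /=; case: b b' => [] [].
case/andP: Enth => /eqP E1; rewrite -Eh in E1 *.
by move/(inj _ _ lj (leq_ltn_trans ij lj)): E1 => <-; rewrite eqxx.
Qed.

(** Induction on the length: without its last step the walk has distinct vertices, without its first
    step the endpoint differs from all vertices but the start, and [closed_walk] separates it from
    the start. *)
Lemma walk_uniq h p : path reduced h p ->
  uniq (rcons (map hv (h :: p)) (walk_end h p)).
Proof.
elim: {p}(size p).+1 {-2}p h (ltnSn (size p)) => // m IH p h; rewrite ltnS => pm hp.
have un : uniq (map hv (h :: p)).
  case/lastP: p pm hp => // p l; rewrite size_rcons rcons_path => pm /andP[hp /andP[/eqP El _]].
  by rewrite -rcons_cons map_rcons -El; apply: IH.
rewrite rcons_uniq un andbT inE negb_or closed_walk //=.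
case: p pm hp {un} => // h' p pm /= /andP[_ hp].
by have := IH p h' pm hp; rewrite rcons_uniq => /andP[].
Qed.

(** If the first steps differed, one walk run backwards and then the other would form a closed
    reduced walk. *)
Lemma walk_unique h p h' p' : path reduced h p -> path reduced h' p' ->
  hv h = hv h' -> walk_end h p = walk_end h' p' -> h :: p = h' :: p'.
Proof.
have closed g q : path reduced g q -> walk_end g q != hv g.
  by move/walk_uniq; rewrite rcons_uniq inE negb_or => /andP[/andP[]].
have same g q g' q' : path reduced g q -> path reduced g' q' -> hv g = hv g' ->
    walk_end g q = walk_end g' q' -> g = g'.
  move=> gq gq' E0 E1; apply/eqP/negPn/negP => ng.
  have := closed _ _ (reverse_path gq (walk_junction E0 ng) gq').
  by rewrite /walk_end last_cat /= -[hv (flip (last g' q'))]E1 /walk_end eqxx.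
elim: p h h' p' => [|a p IH] h h' p' hp hp' E0 E1; have Eh := same _ _ _ _ hp hp' E0 E1; subst h'.
  case: p' hp' E1 => // b q /= /andP[/andP[/eqP Eb _] /closed] + E1.
  by move: E1; rewrite /walk_end /= -Eb => ->; rewrite eqxx.
case: p' hp' E1 => [|b q].
  move: hp => /= /andP[/andP[/eqP Eb _] /closed] + _ E1.
  by move: E1; rewrite /walk_end /= -Eb => ->; rewrite eqxx.
move: hp => /= /andP[/andP[/eqP Ea _] hp] /andP[/andP[/eqP Eb _] hq] E1.
by congr (_ :: _); apply: IH; rewrite // -Ea -Eb.
Qed.
End Walks.

(** * Faces *)

Lemma porbit3 (T : finType) (s : {perm T}) x : #|porbit s x| = 3 ->
  [/\ s (s (s x)) = x, s x != x & s (s x) != x].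
Proof.
move=> E; have := iter_porbit s x; have := uniq_traject_porbit s x; rewrite E /=.
by rewrite !inE negb_or => /andP[/andP[+ +] _] ->; split=> //; rewrite eq_sym.
Qed.

Section Faces.
Variables (n : nat) (D : tensor_diagram n).
Local Notation rot := (rotation D).
Local Notation next := (@next_in_face n D).
Local Notation hv := (@half_edge_at n D).
Implicit Types (x y : dart D) (h g : edge D * bool).

Lemma oppositeK : involutive (@opposite n D).
Proof.
by case=> [[e b]|[i []]] /=; rewrite ?negbK ?ordSK ?ord_predK.
Qed.

Lemma next_inj : injective next.
Proof. by move=> x y /perm_inj /(can_inj oppositeK). Qed.

Lemma vertex_rot x : vertex_of (rot x) = vertex_of x.
Proof.
by have := mem_porbit rot 1 x; rewrite expg1 rotationP => /eqP/esym.
Qed.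

Hypothesis deg1 : forall i : 'I_n, degree (inl i : vertex D) = 1.

(** A boundary vertex carries one edge and the ends of two arcs of the circle, so it looks trivalent
    too. *)
Lemma card_rotation x : #|porbit rot x| = 3.
Proof.
have -> : #|porbit rot x| = #|[set y | vertex_of y == vertex_of x]|.
  by apply: eq_card => y; rewrite inE rotationP eq_sym.
case Ev : (vertex_of x) => [i|v].
  have -> : [set y : dart D | vertex_of y == inl i] =
      (inl @: [set h | hv h == inl i]) :|: [set inr (i, true); inr (i, false)].
    apply/setP=> -[h|[j b]]; rewrite !inE /=.
      by rewrite orbF (mem_imset _ _ (@inl_inj _ _)) inE.
    have -> : (inr (j, b) \in [set inl h | h in [set h | hv h == inl i]]) = false.
      by apply/imsetP => -[].
    rewrite orFb; apply/idP/idP => [/eqP[->]|/orP[/eqP[-> _]|/eqP[-> _]]] //.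
    by case: (b); rewrite eqxx ?orbT.
  rewrite cardsU card_imset; last exact: inl_inj.
  have ne : inr (i, true) != inr (i, false) :> dart D by apply/eqP => -[].
  rewrite cards2 ne (eqP (_ : inl @: _ :&: _ == set0)); last first.
    apply/eqP/setP => y; rewrite !inE; apply/negP => /andP[/imsetP[h _ ->]].
    by [].
  by rewrite cards0 subn0; have := deg1 i; rewrite /degree => ->.
have -> : [set y : dart D | vertex_of y == inr v] = inl @: [set h | hv h == inr v].
  apply/setP=> -[h|[j b]]; rewrite inE /=.
    by rewrite (mem_imset _ _ (@inl_inj _ _)) inE.
  by apply/esym/negP => /imsetP[].
by rewrite card_imset; [exact: trivalentP | exact: inl_inj].
Qed.

Lemma rot3 x : rot (rot (rot x)) = x.
Proof. by have [] := porbit3 (card_rotation x). Qed.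

Lemma rot_neq x : rot x != x.
Proof. by have [] := porbit3 (card_rotation x). Qed.

Lemma rot2_neq x : rot (rot x) != x.
Proof. by have [] := porbit3 (card_rotation x). Qed.

(** [boundaryP] fixes one step of a 3-cycle; the edge is the only dart left between the outgoing arc
    and the incoming one. *)
Lemma rot_boundary i h : hv h = inl i ->
  rot (inl h) = inr (i, false) /\ rot (inr (i, true)) = inl h.
Proof.
move=> hi; have ri := boundaryP D i.
have r3 : rot (rot (inr (i, true))) = inr (i, false).
  by apply: (@perm_inj _ rot); rewrite rot3 ri.
suff E : rot (inr (i, true)) = inl h by rewrite -E.
have := vertex_rot (inr (i, true)); have := rot_neq (inr (i, true)).
have := rot2_neq (inr (i, false)); rewrite ri.
case: (rot (inr (i, true))) => [h'|[j b]] /=; last first.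
  by case: b => nf nt [E]; [rewrite E eqxx in nt | rewrite E eqxx in nf].
move=> _ _ Eh'; congr inl.
have /eqP/cards1P[g Eg] := deg1 i.
have: h \in [set h | hv h == inl i] by rewrite inE hi.
have: h' \in [set h | hv h == inl i] by rewrite inE; apply/eqP.
by rewrite Eg !inE => /eqP -> /eqP ->.
Qed.

Lemma rot_internal x v : vertex_of x = inr v -> exists h, x = inl h /\ hv h = inr v.
Proof. by case: x => [h|[]] //= E; exists h. Qed.

Lemma reduced_rot h h' : rot (inl h) = inl h' -> reduced (flip h) h'.
Proof.
move=> E; rewrite /reduced flipK; apply/andP; split.
  by have := vertex_rot (inl h); rewrite E => Ev; apply/eqP/esym.
by have := rot_neq (inl h); rewrite E; apply: contra => /eqP ->.
Qed.

Lemma reduced_rot2 h h' : rot (rot (inl h)) = inl h' -> reduced (flip h) h'.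
Proof.
move=> E; rewrite /reduced flipK; apply/andP; split.
  have := vertex_rot (rot (inl h)); rewrite E vertex_rot => Ev; exact/eqP/esym.
by have := rot2_neq (inl h); rewrite E; apply: contra => /eqP ->.
Qed.

Definition same_face x y := fconnect next x y.

Lemma same_face_refl x : same_face x x. Proof. exact: connect0. Qed.

Lemma same_face_sym x y : same_face x y = same_face y x.
Proof. exact: fconnect_sym next_inj _ _. Qed.

Lemma same_face_trans x y z : same_face x y -> same_face y z -> same_face x z.
Proof. exact: connect_trans. Qed.

Lemma same_face_next x : same_face x (rot (opposite x)).
Proof. exact: fconnect1. Qed.

Definition leaf_index (n0 : 0 < n) (s : nat) : 'I_n := Ordinal (ltn_pmod s n0).

Variable n0 : 0 < n.

(* The face inside of the disk next to the arc which arrives at s. *)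
Definition face_dart (s : nat) : dart D := inr (leaf_index n0 s, false).

(** One face step from the arc arriving at [i.+1] runs back along it to [i] and turns onto the edge
    of that leaf. *)
Lemma same_face_boundary h i : hv h = inl i -> same_face (inl h) (face_dart i.+1).
Proof.
move=> hi; have [_ E] := rot_boundary hi; rewrite same_face_sym.
have -> : face_dart i.+1 = inr (ordS i, false) by congr (inr (_, _)); apply: val_inj.
by apply: (same_face_trans (same_face_next _)); rewrite /= ordSK E same_face_refl.
Qed.

Lemma face_dart_mod s s' : s = s' %[mod n] -> face_dart s = face_dart s'.
Proof. by move=> E; congr (inr (_, _)); apply: val_inj. Qed.

End Faces.

(** * Euler's formula: distinct arcs border distinct inner faces *)

Section Euler.
Variables (n : nat) (D : tensor_diagram n) (n0 : 0 < n).
Local Notation V := (vertex D).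
Local Notation rot := (rotation D).
Local Notation next := (@next_in_face n D).
Local Notation hv := (@half_edge_at n D).
Local Notation leaf_index := (leaf_index n0).
Local Notation face_dart := (face_dart D n0).

Lemma adjacentP u v : reflect (exists h, hv h = u /\ hv (flip h) = v) (adjacent u v : bool).
Proof.
apply: (iffP existsP) => [[h /andP[/eqP <- /eqP <-]]|[h [<- <-]]]; first by exists h.
by exists h; rewrite !eqxx.
Qed.

(** The set [B] of vertices reached grows by one vertex along one new edge of [A] at a time, which
    preserves [#|B| <= #|A| + 1]. *)
Lemma connected_card : connected D -> #|V| <= #|edge D| + 1.
Proof.
move=> conn; pose v0 : V := inl (leaf_index 0).
suff grow m (B : {set V}) (A : {set edge D}) : #|~: B| <= m -> v0 \in B ->
    #|B| <= #|A| + 1 -> (forall h, h.1 \in A -> hv h \in B) -> #|V| <= #|edge D| + 1.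
  apply: (grow _ [set v0] set0 (leqnn _)); rewrite ?inE ?cards1 ?cards0 //.
  by move=> h; rewrite in_set0.
elim: m B A => [|m IH] B A Bm v0B BA AB.
  move: Bm; rewrite leqn0 cards_eq0 => /eqP /(congr1 (@setC _)); rewrite setCK setC0 => EB.
  by apply: leq_trans (leq_add (max_card (mem A)) (leqnn 1)); rewrite -cardsT -EB.
have [/eqP EB|nB] := boolP (B == setT).
  by apply: leq_trans (leq_add (max_card (mem A)) (leqnn 1)); rewrite -cardsT -EB.
have [h /andP[hB nhB]|no] := pickP (fun h => (hv h \in B) && (hv (flip h) \notin B)).
  have hA : h.1 \notin A.
    by apply: contra nhB => hA; apply: AB.
  apply: (IH (hv (flip h) |: B) (h.1 |: A)).
  - rewrite setCU setIC -setDE; have := cardsD1 (hv (flip h)) (~: B).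
    by rewrite inE nhB /= => EB; move: Bm; rewrite EB.
  - by rewrite inE v0B orbT.
  - by rewrite !cardsU1 nhB hA; lia.
  - move=> h'; rewrite !inE => /orP[/eqP E|/AB ->]; last by rewrite orbT.
    case: h h' hB {nhB hA} E => e b [e' b'] /= hB ->; rewrite /flip /=.
    by case: b hB; case: b' => /= hB; rewrite ?hB ?eqxx ?orbT.
case/negP: nB; apply/eqP/setP => v; rewrite inE.
have cl : closed (@adjacent n D) (mem B).
  move=> u w /adjacentP[h [<- <-]]; apply/idP/idP => hB.
    by have := no h; rewrite hB => /negbT; rewrite negbK.
  by have := no (flip h); rewrite flipK hB => /negbT; rewrite negbK.
by have := closed_connect cl (conn v0 v); rewrite v0B => <-.
Qed.

Lemma linked_components : connected D -> n_comp (@linked n D) V = 1.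
Proof.
move=> conn; have all u v : connect (@linked n D) u v.
  apply: connect_sub (conn u v) => {}u {}v /adjacentP[h [<- <-]].
  by apply: connect1; apply/existsP; case: h => e b; exists (inl (e, b)); apply/andP; split; apply/eqP.
pose v0 : V := inl (leaf_index 0).
have sym : connect_sym (@linked n D) by move=> u v; rewrite !all.
rewrite -(n_comp_connect sym v0); apply: eq_n_comp_r => v.
by rewrite !inE all.
Qed.

Hypotheses (conn : connected D) (plan : planar D).
Hypothesis acyclic : forall c, ~~ @graph_cycle n D c.
Hypothesis deg1 : forall i : 'I_n, degree (inl i : V) = 1.

Lemma leaf_indexS k : leaf_index k.+1 = ordS (leaf_index k).
Proof. by apply: val_inj; rewrite /= -addn1 -[in RHS]addn1 modnDml. Qed.

Lemma leaf_index_val (i : 'I_n) : leaf_index i = i.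
Proof. by apply: val_inj; rewrite /= modn_small. Qed.

Lemma same_face_circle i : same_face (inr (leaf_index 0, true) : dart D) (inr (i, true)).
Proof.
rewrite -(leaf_index_val i); elim: (val i) => [|k IH]; first exact: same_face_refl.
apply: (same_face_trans IH); apply: (same_face_trans (same_face_next _)).
by rewrite /= leaf_indexS boundaryP same_face_refl.
Qed.

(** [None] names the outer face, which contains all darts [inr (i, true)]. With the inner sides of
    the arcs this makes [n + 1] candidates for the faces. *)
Definition face_repr (o : option 'I_n) : dart D :=
  if o is Some i then inr (i, false) else inr (leaf_index 0, true).

Lemma face_reprP (x : dart D) : exists o, same_face x (face_repr o).
Proof.
have [/existsP //|/existsPn nf] := boolP [exists o, same_face x (face_repr o)].
(* A reduced walk of [#|V| + 1] steps would visit [#|V| + 2] distinct vertices. *)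
exfalso; suff [h [p [_ hp sp]]] : exists h p, [/\ x = inl h, path (@reduced n D) h p & size p = #|V|].
  have := walk_uniq acyclic hp => /card_uniqP.
  rewrite size_rcons size_map /= sp => E.
  by have := max_card (mem (rcons [seq hv i | i <- h :: p] (walk_end h p))); rewrite E; lia.
elim: #|V| x nf => [|m IH] x nf.
  case: x nf => [h|[i []]] nf; first by exists h, [::].
    by have := nf None; rewrite same_face_sym // same_face_circle.
  by have := nf (Some i); rewrite same_face_refl.
have [o|h' [p [Eh' hp sp]]] := IH (rot (opposite x)).
  apply: contra (nf o); apply: same_face_trans; exact: same_face_next.
case: x nf Eh' => [[e b]|[i []]] nf Eh'.
- have r := reduced_rot deg1 (Eh' : rot (inl (flip (e, b))) = inl h').
  by rewrite flipK in r; exists (e, b), (h' :: p); rewrite /= r hp sp.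
- by have := nf None; rewrite same_face_sym // same_face_circle.
- by have := nf (Some i); rewrite same_face_refl.
Qed.

(** Euler's formula and [connected_card] give at least [n + 1] faces, and the [n + 1] darts of
    [face_repr] reach every face; hence no two of them share one. *)
Lemma face_dart_inj s s' : same_face (face_dart s) (face_dart s') -> s = s' %[mod n].
Proof.
have inj : injective (froot next \o face_repr).
  have := @leq_image_card _ _ (froot next \o face_repr) predT.
  have sub : {subset froots next <= codom (froot next \o face_repr)}.
    move=> x /eqP rx; have [o xo] := face_reprP x.
    apply/codomP; exists o; rewrite /= -rx; apply/eqP.
    by rewrite (root_connect (fconnect_sym (@next_inj n D))).
  have le : n.+1 <= #|codom (froot next \o face_repr)|.
    apply: leq_trans (subset_leq_card (introT subsetP sub)).
    have := connected_card conn; move: plan; rewrite /planar linked_components // => E C.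
    have -> : #|froots next| = fcard next (dart D).
      by apply: eq_card => x; rewrite !inE andbT.
    move: E C; set f := fcard _ _; lia.
  rewrite -[codom _]/(image (froot next \o face_repr) predT) in le.
  move=> ub; have /image_injP : #|image (froot next \o face_repr) predT| == #|{: option 'I_n}|.
    by rewrite eqn_leq ub card_option card_ord le.
  by move=> inj o o'; apply: inj.
move=> same; have : Some (leaf_index s) = Some (leaf_index s').
  apply: inj; apply/eqP; rewrite /= (root_connect (fconnect_sym (@next_inj n D))).
  exact: same.
by case.
Qed.
End Euler.

(** * Rotation of the rectangles seed *)

(* The vertices of the rectangles seed are coded by pairs (r, i) where r is the
   row and i the first column, both numbered from 0, of the Plücker coordinate
   at the vertex; with N = n - 3 the vertex None is then (0, N) and looks like
   one more vertex of the first row. *)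
Definition code_ok N (u : nat * nat) := (u.1 < 3) && (u.2 < N) || (u.1 == 0) && (u.2 == N).

Definition code_frozen N (u : nat * nat) := [|| u.1 == 2, u.2 == 0 | u.2 == N].

Definition mutate_fun (A : nat * nat -> nat * nat -> nat) m u v :=
  let pre u v := if (u == m) || (v == m) then A v u else A u v + A u m * A m v in
  pre u v - pre v u.

(* The arrows, except those between frozen vertices, after mutations at
   (0, 1), ..., (0, t). *)
Definition quiver1 (N t : nat) (u v : nat * nat) : bool :=
  let: (r, i) := u in let: (s, j) := v in
  match r, s with
  | 0, 0 => [|| (i == j.+1) && ((1 <= j < t) || (t < j)), [&& i == t, j == t.+1 & 0 < t],
                [&& i == 0, j == t & 0 < t] | (i == t.+1) && (j == 0)]
  | 0, 1 => [|| [&& j == i.+1, 0 < i & i < t], (j == i) && (t < i),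
                [&& i == 1, j == 0 & 0 < t] | [&& i == N, j == N.-1 & t == N.-1]]
  | 1, 0 => [|| [&& i == j, 0 < j & j <= t], [&& j == i.+1, t.+1 < j & j < N]
              | [&& t == 0, i == 0 & j == 1]]
  | 1, 1 => (i == j.+1) && ((0 < j) || (t == 0))
  | 1, 2 => i == j
  | 2, 1 => j == i.+1
  | _, _ => false
  end.

(* The same after mutations at (0, 1), ..., (0, N - 1), (1, 1), ..., (1, t). *)
Definition quiver2 (N t : nat) (u v : nat * nat) : bool :=
  let: (r, i) := u in let: (s, j) := v in
  match r, s with
  | 0, 0 => [|| [&& i == j.+1, 0 < j & i < N], [&& i == N.-1, j == N & t < N.-1]
              | (i == 0) && (j == N.-1)]
  | 0, 1 => [|| (i == 1) && (j == 0), [&& i == j, 0 < j & j <= t],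
                [&& j == i.+1, t < i & 0 < i] | [&& i == N, j == N.-1 & t < N.-1]]
  | 1, 0 => [|| [&& j == i.+1, 0 < i & j <= t], (i == j) && (t < i)
              | [&& i == N.-1, j == N & t == N.-1]]
  | 1, 1 => [&& i == j.+1, 0 < j & (i <= t) || (t.+1 < i)] || [&& i == t, 0 < t & j == t.+1]
  | 1, 2 => [|| [&& j == i.+1, 0 < i & i < t], (j == i) && (t < i)
              | [&& i == 1, j == 0 & 0 < t]]
  | 2, 0 => [&& i == 0, j == 1 & 0 < t]
  | 2, 1 => [&& i == j, 0 < j & j <= t] || (j == i.+1) && ((t.+1 < j) || (t == 0))
  | _, _ => false
  end.

(** The rotation permutes the [n] frozen brackets cyclically, and their vertices move along. A
    mutable vertex stays in place, since mutation has put the rotated bracket there. *)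
Definition rot_code N (u : nat * nat) : nat * nat :=
  let: (r, i) := u in
  if (r < 2) && (i == 0) then (r.+1, 0)
  else if r == 2 then (if i == N.-1 then (0, N) else (2, i.+1))
  else if i == N then (0, 0) else u.

Ltac split_atom := match goal with
 | |- context[@eq_op _ ?a ?b] => let E := fresh "E" in case E: (a == b)
 | |- context[leq ?a ?b] => let E := fresh "E" in case E: (leq a b)
 end; rewrite ?andbF ?andbT ?orbT ?orbF //=; try (exfalso; lia).

Ltac quiver_step :=
  let r := fresh "r" in let s := fresh "s" in
  case=> r ? [s ?]; rewrite /code_ok /code_frozen /mutate_fun /= ?xpair_eqE;
  case: r => [|[|[|r]]] //=; case: s => [|[|[|s]]] //=;
  rewrite ?muln0 ?mul0n ?addn0 ?subn0 ?orbF ?andbT ?andbF ?mulnb //=;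
  move=> ? ? ?; rewrite ?eqxx ?ltnn ?eqSS ?ltnS ?ltnSn ?leqnn /=;
  solve [repeat split_atom].

Section Quivers.
Local Open Scope nat_scope.
Implicit Types u v : nat * nat.

Lemma quiver1_step N t : t.+1 < N -> forall u v, code_ok N u -> code_ok N v ->
  ~~ (code_frozen N u && code_frozen N v) ->
  mutate_fun (fun u v => quiver1 N t u v) (0, t.+1) u v = quiver1 N t.+1 u v.
Proof. move=> tN. quiver_step. Qed.

Lemma quiver2_step N t : t.+1 < N -> forall u v, code_ok N u -> code_ok N v ->
  ~~ (code_frozen N u && code_frozen N v) ->
  mutate_fun (fun u v => quiver2 N t u v) (1, t.+1) u v = quiver2 N t.+1 u v.
Proof. move=> tN. quiver_step. Qed.

Lemma quiver12 N : 1 < N -> forall u v, code_ok N u -> code_ok N v ->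
  ~~ (code_frozen N u && code_frozen N v) ->
  quiver2 N 0 u v = quiver1 N N.-1 u v.
Proof. move=> N1. quiver_step. Qed.

Lemma quiver_rot N : 1 < N -> forall u v, code_ok N u -> code_ok N v ->
  ~~ (code_frozen N u && code_frozen N v) ->
  quiver2 N N.-1 (rot_code N u) (rot_code N v) = quiver1 N 0 u v.
Proof.
move=> N1 [r i] [s j]; rewrite /code_ok /code_frozen /rot_code.
case: r => [|[|[|r]]] //=; case: s => [|[|[|s]]] //= => ? ? ?.
all: (do ![case: ifP => ? //=]).
all: solve [repeat split_atom].
Qed.
End Quivers.

Import Order.TTheory GRing.Theory Num.Theory.
Local Open Scope ring_scope.

(** * Seeds *)

Lemma prod_inj (R : comPzRingType) (I J : finType) (f : I -> J) (G : J -> R) :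
  injective f -> (forall j, (forall i, j != f i) -> G j = 1) ->
  \prod_j G j = \prod_i G (f i).
Proof.
move=> injf G1; rewrite (bigID (mem (codom f))) /= [X in _ * X]big1 ?mulr1.
  have uf : uniq (codom f) by rewrite map_inj_uniq ?enum_uniq.
  rewrite (eq_bigl [in codom f]) // -(big_uniq _ uf) /=.
  by rewrite big_map big_enum.
move=> j /codomP jf; apply: G1 => i; apply/eqP => E; apply: jf.
by exists i.
Qed.

Lemma prod_count (R : comPzRingType) (I : finType) (G : I -> R) (s : seq I) :
  \prod_i G i ^+ count_mem i s = \prod_(i <- s) G i.
Proof.
elim: s => [|a s IH]; first by rewrite big_nil big1.
rewrite big_cons -IH (bigD1 a) //= [in RHS](bigD1 a) //= eqxx add1n exprS mulrA.
congr (_ * _); apply: eq_bigr => i /negPf ia.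
by rewrite eq_sym ia add0n.
Qed.

Section FieldRel.
Variables F F' : fieldType.

(** What a relation needs to pass through an exchange relation. Inversion asks for [x' != 0], since
    a substitution could annihilate a denominator. *)
Definition field_rel (P : F -> F' -> Prop) : Prop :=
  [/\ P 1 1,
      forall x y x' y', P x x' -> P y y' -> P (x + y) (x' + y'),
      forall x y x' y', P x x' -> P y y' -> P (x * y) (x' * y')
    & forall x x', x' != 0 -> P x x' -> P x^-1 x'^-1].

Lemma field_rel_prod P (I : finType) (G : I -> F) (G' : I -> F') (d : I -> nat) :
  field_rel P -> (forall i, P (G i) (G' i)) ->
  P (\prod_i G i ^+ d i) (\prod_i G' i ^+ d i).
Proof.
case=> P1 _ PM _ PG; apply: (big_rec2 P) => // i x x' _ Px; apply: (PM) => //.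
by elim: (d i) => [|k IH]; rewrite ?expr0 // !exprS; apply: PM.
Qed.

(** The operations of a mutation are subtraction-free, so they stay in such a set; [~ P 0] then
    makes every variable nonzero. *)
Definition positive_cone (P : F -> Prop) : Prop :=
  [/\ P 1, ~ P 0, forall x y, P x -> P y -> P (x + y),
      forall x y, P x -> P y -> P (x * y) & forall x, P x -> P x^-1].

End FieldRel.

Lemma field_rel_eq (F : fieldType) : field_rel (@eq F).
Proof. by split=> // [x y x' y' -> ->|x y x' y' -> ->|x x' _ ->]. Qed.

Section PositiveSeed.
Variables (F : fieldType) (Q : finType) (P : F -> Prop).
Hypothesis Pcone : positive_cone P.

Lemma mutation_positive (S0 S : seed F Q) :
  (forall v, P (variable S0 v)) -> mutation_equivalent S0 S ->
  forall v, P (variable S v).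
Proof.
move=> PS0; elim=> // {}S m _ PS _ v /=.
case: Pcone => P1 _ PD PM PV.
have Pprod d : P (\prod_u variable S u ^+ d u).
  apply: big_rec => // u x _ Px; apply: (PM) => //.
  by elim: (d u) => [|k IH]; rewrite ?expr0 // exprS; apply: PM.
rewrite /mutate_variable; case: eqP => // _.
by apply: (PM); [apply: PD; apply: Pprod | apply: PV].
Qed.

Lemma positive_neq0 (S0 S : seed F Q) v :
  (forall v, P (variable S0 v)) -> mutation_equivalent S0 S ->
  variable S v != 0.
Proof.
move=> PS0 /(mutation_positive PS0) /(_ v) PS; apply/eqP => E.
by case: Pcone => _ + _ _ _; apply; rewrite -E.
Qed.

End PositiveSeed.

Lemma mutation_equivalent_trans (F : fieldType) (Q : finType) (S0 S1 S2 : seed F Q) :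
  mutation_equivalent S0 S1 -> mutation_equivalent S1 S2 ->
  mutation_equivalent S0 S2.
Proof. by move=> E; elim=> // S m _ IH fm; apply: Mut_step. Qed.

Lemma mutation_frozen (F : fieldType) (Q : finType) (S0 S : seed F Q) :
  mutation_equivalent S0 S -> frozen S = frozen S0.
Proof. by elim. Qed.

Lemma mutation_frozen_variable (F : fieldType) (Q : finType) (S0 S : seed F Q) v :
  mutation_equivalent S0 S -> frozen S0 v -> variable S v = variable S0 v.
Proof.
elim=> // {}S m E IH fm fv /=; rewrite /mutate_variable.
case: eqP fm => [<-|_ _]; last exact: IH.
by rewrite (mutation_frozen E) fv.
Qed.

(** Both kinds of variables at once: the promotion takes frozen variables of the smaller seed to
    mutable vertices of the larger one, so the induction cannot separate them. *)
Definition seed_variable (F : fieldType) (Q : finType) (S0 : seed F Q) (z : F) :=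
  exists2 S, mutation_equivalent S0 S & exists v, z = variable S v.

Lemma seed_variableP (F : fieldType) (Q : finType) (S0 : seed F Q) z :
  seed_variable S0 z -> cluster_variable S0 z \/ frozen_variable S0 z.
Proof.
case=> S E [v ->]; have [fv|fv] := boolP (frozen S v); last by left; exists S, v.
by rewrite (mutation_frozen E) in fv; right; exists v; rewrite // (mutation_frozen_variable E).
Qed.

Section Embedding.
Variables (F F' : fieldType) (Q Q' : finType) (P : F -> F' -> Prop).

(* Freezing the vertices of S' which are not images of mutable ones, and
   dropping the isolated ones, gives S up to the arrows between frozen
   vertices. *)
Record embeds (S : seed F Q) (S' : seed F' Q') (f : Q -> Q') : Prop := Embeds {
  embeds_inj : injective f;
  embeds_variable : forall v, P (variable S v) (variable S' (f v));
  embeds_mutable : forall v, ~~ frozen S v -> ~~ frozen S' (f v);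
  embeds_arrows : forall v u, ~~ frozen S v || ~~ frozen S u ->
    arrows S' (f v) (f u) = arrows S v u;
  embeds_out : forall v u', ~~ frozen S v -> (forall u, u' != f u) ->
    arrows S' (f v) u' = 0%N;
  embeds_in : forall v u', ~~ frozen S v -> (forall u, u' != f u) ->
    arrows S' u' (f v) = 0%N
}.

(** The exchange relation and the new arrows at [m] involve only arrows with an end at the mutable
    [m], all preserved by [f]. A vertex outside the image is not joined to [f m], hence gains no
    arrow. *)
Lemma embeds_mutate S S' f m : field_rel P -> embeds S S' f ->
  ~~ frozen S m -> variable S' (f m) != 0 ->
  embeds (mutate S m) (mutate S' (f m)) f.
Proof.
move=> PP E fm nz; have injf := embeds_inj E.
have pre v u : ~~ frozen S v || ~~ frozen S u ->
    premutate_arrows S' (f m) (f v) (f u) = premutate_arrows S m v u.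
  move=> fvu; rewrite /premutate_arrows !inj_eq //; case: ifP => _.
    by apply: (embeds_arrows E); rewrite // orbC.
  by rewrite !(embeds_arrows E) ?fm ?orbT.
have preout v u' : ~~ frozen S v -> (forall u, u' != f u) ->
    premutate_arrows S' (f m) (f v) u' = 0%N.
  move=> fv u'f; rewrite /premutate_arrows (negPf (u'f m)) orbF.
  case: ifP => _; first exact: (embeds_in E fv u'f).
  by rewrite (embeds_out E fv u'f) (embeds_out E fm u'f) muln0.
have prein v u' : ~~ frozen S v -> (forall u, u' != f u) ->
    premutate_arrows S' (f m) u' (f v) = 0%N.
  move=> fv u'f; rewrite /premutate_arrows (negPf (u'f m)) orFb.
  case: ifP => _; first exact: (embeds_out E fv u'f).
  by rewrite (embeds_in E fv u'f) (embeds_in E fm u'f).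
split=> //=.
- move=> v; rewrite /mutate_variable inj_eq //; case: ifP => _; last exact: (embeds_variable E).
  case: (PP) => _ PD PM PV.
  rewrite (prod_inj injf (G := fun u' => _ ^+ arrows S' (f m) u')); last first.
    by move=> u' u'f; rewrite (embeds_out E fm u'f).
  rewrite (prod_inj injf (G := fun u' => _ ^+ arrows S' u' (f m))); last first.
    by move=> u' u'f; rewrite (embeds_in E fm u'f).
  apply: PM; last by apply: PV => //; exact: (embeds_variable E).
  apply: PD.
    rewrite [X in P _ X](eq_bigr (fun u => variable S' (f u) ^+ arrows S m u)).
      by apply: field_rel_prod => // u; exact: (embeds_variable E).
    by move=> u _; rewrite (embeds_arrows E) ?fm.
  rewrite [X in P _ X](eq_bigr (fun u => variable S' (f u) ^+ arrows S u m)).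
    by apply: field_rel_prod => // u; exact: (embeds_variable E).
  by move=> u _; rewrite (embeds_arrows E) ?fm ?orbT.
- exact: (embeds_mutable E).
- by move=> v u fvu; rewrite /mutate_arrows !pre // orbC.
- by move=> v u' fv u'f; rewrite /mutate_arrows (preout _ _ fv u'f).
- by move=> v u' fv u'f; rewrite /mutate_arrows (prein _ _ fv u'f).
Qed.

Lemma embeds_equivalent S0 S0' f S : field_rel P ->
  (forall S' v, mutation_equivalent S0' S' -> variable S' v != 0) ->
  embeds S0 S0' f -> mutation_equivalent S0 S ->
  exists2 S', mutation_equivalent S0' S' & embeds S S' f.
Proof.
move=> PP nz E0; elim=> [|{}S m E [S' ES' emb] fm]; first by exists S0' => //; apply: Mut_refl.
exists (mutate S' (f m)); last by apply: embeds_mutate => //; apply: nz.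
by apply: Mut_step => //; apply: embeds_mutable emb _ fm.
Qed.

End Embedding.

Lemma embeds_comp (F F' : fieldType) (Q Q' Q'' : finType) (P : F -> F' -> Prop)
  (S : seed F Q) (S' : seed F' Q') (S'' : seed F' Q'') f g :
  embeds P S S' f -> embeds eq S' S'' g -> embeds P S S'' (g \o f).
Proof.
move=> E E'; split=> /=.
- exact: inj_comp (embeds_inj E') (embeds_inj E).
- by move=> v; rewrite -(embeds_variable E'); exact: (embeds_variable E).
- by move=> v fv; apply: (embeds_mutable E'); apply: (embeds_mutable E).
- move=> v u fvu; rewrite (embeds_arrows E') ?(embeds_arrows E) //.
  by case/orP: fvu => /(embeds_mutable E) ->; rewrite ?orbT.
- move=> v u' /[dup] fv /(embeds_mutable E) f'v u'gf.
  have [/codomP[w uw]|/codomP ng] := boolP (u' \in codom g).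
    rewrite uw (embeds_arrows E') ?f'v // (embeds_out E) // => u.
    by have:= u'gf u; rewrite uw inj_eq //; exact: embeds_inj E'.
  by apply: (embeds_out E') => // w; apply/eqP => uw; apply: ng; exists w.
- move=> v u' /[dup] fv /(embeds_mutable E) f'v u'gf.
  have [/codomP[w uw]|/codomP ng] := boolP (u' \in codom g).
    rewrite uw (embeds_arrows E') ?f'v ?orbT // (embeds_in E) // => u.
    by have:= u'gf u; rewrite uw inj_eq //; exact: embeds_inj E'.
  by apply: (embeds_in E') => // w; apply/eqP => uw; apply: ng; exists w.
Qed.

(** * Fraction fields *)

Local Notation "x %:FF" := (@tofrac _ x) (at level 2, format "x %:FF").

Section Fractions.
Variables (A B : idomainType) (phi : {rmorphism A -> B}).

(* The graph of the extension of phi to the localization of A at its kernel. *)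
Definition frac_rel (z : {fraction A}) (z' : {fraction B}) : Prop :=
  exists a b, [/\ phi b != 0, z = a%:FF / b%:FF & z' = (phi a)%:FF / (phi b)%:FF].

Lemma rmorph_neq0 b : phi b != 0 -> b != 0.
Proof. by apply: contraNneq => ->; rewrite rmorph0. Qed.

Lemma frac_rel_tofrac a : frac_rel a%:FF (phi a)%:FF.
Proof. by exists a, 1; rewrite !rmorph1 !divr1; split; rewrite ?oner_neq0. Qed.

(** Clearing denominators leaves an identity of polynomials, to which [phi] applies. *)
Lemma frac_rel_fun a z' : frac_rel a%:FF z' -> z' = (phi a)%:FF.
Proof.
case=> c [d [nd E ->]]; have nd' := rmorph_neq0 nd.
have dF : d%:FF != 0 by rewrite tofrac_eq0.
have dF' : (phi d)%:FF != 0 by rewrite tofrac_eq0.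
apply: (canLR (mulfK dF')).
rewrite -rmorphM /= -rmorphM /=; congr (_ (phi _)).
by apply/eqP; rewrite -tofrac_eq rmorphM /= E divfK.
Qed.

Lemma frac_rel_field : field_rel frac_rel.
Proof.
split.
- by have:= frac_rel_tofrac 1; rewrite !rmorph1.
- move=> x y x' y' [a [b [nb -> ->]]] [c [d [nd -> ->]]].
  exists (a * d + c * b), (b * d).
  have [nb' nd'] := (rmorph_neq0 nb, rmorph_neq0 nd).
  rewrite !(rmorphM, rmorphD) /= mulf_neq0 //.
  by split=> //; rewrite addf_div ?tofrac_eq0.
- move=> x y x' y' [a [b [nb -> ->]]] [c [d [nd -> ->]]].
  exists (a * c), (b * d).
  have [nb' nd'] := (rmorph_neq0 nb, rmorph_neq0 nd).
  rewrite !(rmorphM, rmorphD) /= mulf_neq0 //.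
  by split=> //; rewrite mulf_div.
- move=> x x' nx' [a [b [nb Ex Ex']]]; exists b, a; rewrite Ex Ex' !invf_div; split=> //.
  by apply: contraNneq nx' => a0; rewrite Ex' a0 rmorph0 mul0r.
Qed.

End Fractions.

Section PositiveFractions.
Variables (A : idomainType) (K : numFieldType) (ev : {rmorphism A -> K}).

Definition frac_pos (z : {fraction A}) : Prop :=
  exists a b, [/\ 0 < ev a, 0 < ev b & z = a%:FF / b%:FF].

Lemma pos_neq0 b : 0 < ev b -> b%:FF != 0.
Proof. by rewrite tofrac_eq0; apply: contraTneq => ->; rewrite rmorph0 ltxx. Qed.

Lemma frac_pos_tofrac a : 0 < ev a -> frac_pos a%:FF.
Proof. by move=> a0; exists a, 1; rewrite !rmorph1 divr1; split. Qed.

Lemma frac_pos_cone : positive_cone frac_pos.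
Proof.
split.
- by rewrite -tofrac1; apply: frac_pos_tofrac; rewrite rmorph1.
- case=> a [b [pa pb /esym/eqP]]; rewrite mulf_eq0 invr_eq0.
  by rewrite (negPf (pos_neq0 pa)) (negPf (pos_neq0 pb)).
- move=> x y [a [b [pa pb ->]]] [c [d [pc pd ->]]].
  exists (a * d + c * b), (b * d).
  rewrite !(rmorphM, rmorphD) /= addf_div ?pos_neq0 //.
  by rewrite addr_gt0 ?mulr_gt0.
- move=> x y [a [b [pa pb ->]]] [c [d [pc pd ->]]].
  exists (a * c), (b * d).
  by rewrite !(rmorphM, rmorphD) /= mulf_div !mulr_gt0.
- by move=> x [a [b [pa pb ->]]]; exists b, a; rewrite invf_div.
Qed.

End PositiveFractions.

(** * Volumes and cross products *)

Section Volume.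
Variable A : comNzRingType.
Implicit Types a b c d e : 'rV[A]_3.

Definition entry a (k : nat) : A := a 0 (inord k).

Lemma entryE a (k : 'I_3) : a 0 k = entry a k.
Proof. by rewrite /entry inord_val. Qed.

Lemma entry_inj a b : entry a 0 = entry b 0 -> entry a 1 = entry b 1 ->
  entry a 2 = entry b 2 -> a = b.
Proof.
move=> E0 E1 E2; apply/rowP=> k; rewrite !entryE.
by case: k => [[|[|[|k]]] lk].
Qed.

Lemma volumeE a b c : volume a b c =
  entry a 0 * (entry b 1 * entry c 2 - entry b 2 * entry c 1)
  - entry a 1 * (entry b 0 * entry c 2 - entry b 2 * entry c 0)
  + entry a 2 * (entry b 0 * entry c 1 - entry b 1 * entry c 0).
Proof.
rewrite /volume (expand_det_row _ ord0) !big_ord_recl big_ord0 /cofactor.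
rewrite !(expand_det_row _ ord0) !big_ord_recl !big_ord0 /cofactor !det_mx11 !mxE /=.
rewrite !entryE /= /bump /=.
ring.
Qed.

Lemma entry_delta j k : (j < 3)%N -> (k < 3)%N ->
  entry (delta_mx 0 (inord j)) k = (j == k)%:R.
Proof.
move=> lj lk; rewrite /entry mxE eqxx /= eq_sym.
by rewrite -(inj_eq val_inj) /= !inordK.
Qed.

Lemma crossE a b k : (k < 3)%N ->
  entry (cross a b) k = volume a b (delta_mx 0 (inord k)).
Proof. by move=> _; rewrite /entry /cross mxE. Qed.

Lemma cross0 a b : entry (cross a b) 0 = entry a 1 * entry b 2 - entry a 2 * entry b 1.
Proof. by rewrite crossE // volumeE !entry_delta //=; ring. Qed.

Lemma cross1 a b : entry (cross a b) 1 = entry a 2 * entry b 0 - entry a 0 * entry b 2.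
Proof. by rewrite crossE // volumeE !entry_delta //=; ring. Qed.

Lemma cross2 a b : entry (cross a b) 2 = entry a 0 * entry b 1 - entry a 1 * entry b 0.
Proof. by rewrite crossE // volumeE !entry_delta //=; ring. Qed.

Lemma entryB a b k : entry (a - b) k = entry a k - entry b k.
Proof. by rewrite /entry !mxE. Qed.

Lemma entryD a b k : entry (a + b) k = entry a k + entry b k.
Proof. by rewrite /entry !mxE. Qed.

Lemma entryZ x a k : entry (x *: a) k = x * entry a k.
Proof. by rewrite /entry !mxE. Qed.

Definition vecE := (volumeE, cross0, cross1, cross2, entryB, entryD, entryZ).

(** A node is thus a combination of two of its inputs whose coefficients are volumes; this gives the
    exchange relations of the promotion and membership in the coordinate ring. *)
Lemma cross_cross a b c d :
  cross (cross a b) (cross c d) = volume a b d *: c - volume a b c *: d.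
Proof. by apply: entry_inj; rewrite !vecE; ring. Qed.

Lemma volume_cross a b c d : volume (cross a b) c d = volume a b (cross c d).
Proof. by rewrite !vecE; ring. Qed.

Lemma volume_rot a b c : volume a b c = volume b c a.
Proof. by rewrite !volumeE; ring. Qed.

Lemma volume_swap a b c : volume b a c = - volume a b c.
Proof. by rewrite !volumeE; ring. Qed.

Lemma volume_aab a b : volume a a b = 0.
Proof. by rewrite !volumeE; ring. Qed.

Lemma volume_lin x y a b c d : volume (x *: a - y *: b) c d =
  x * volume a c d - y * volume b c d.
Proof. by rewrite !vecE; ring. Qed.

End Volume.

Section VolumeMorphism.
Variables (A B : comNzRingType) (phi : {rmorphism A -> B}).
Implicit Types a b c d e : 'rV[A]_3.

Lemma entry_map a k : entry (map_mx phi a) k = phi (entry a k).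
Proof. by rewrite /entry mxE. Qed.

Lemma volume_map a b c : phi (volume a b c) =
  volume (map_mx phi a) (map_mx phi b) (map_mx phi c).
Proof. by rewrite !volumeE !entry_map !(rmorphB, rmorphD, rmorphM). Qed.

Lemma cross_map a b : map_mx phi (cross a b) = cross (map_mx phi a) (map_mx phi b).
Proof.
by apply: entry_inj; rewrite entry_map !vecE !entry_map !(rmorphB, rmorphM).
Qed.
End VolumeMorphism.

(** * Columns and Plücker coordinates *)

(* Sealed, so that unification never unfolds determinants of polynomials. *)
HB.lock Definition vol (A : comPzRingType) (u v w : 'rV[A]_3) : A := volume u v w.

Lemma volE (A : comPzRingType) (u v w : 'rV[A]_3) : vol u v w = volume u v w.
Proof. by rewrite vol.unlock. Qed.

(** Indices are read modulo [n], so that the rotation is [i] to [i.+1]. The default [0] occurs only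
    for [n = 0]. *)
HB.lock Definition column (K : fieldType) (n i : nat) : 'rV[matrix_poly K 3 n]_3 :=
  oapp (fun c : 'I_n => (col c (generic_matrix K 3 n))^T) 0 (insub (i %% n)%N).

Section Columns.
Variables (K : fieldType) (n : nat).
Local Notation M := (matrix_poly K 3 n).

Local Notation column := (column K n).

Lemma columnE (c : 'I_n) : column c = (col c (generic_matrix K 3 n))^T.
Proof. by rewrite column.unlock modn_small // insubT //= => lc; congr ((col _ _)^T); apply: val_inj. Qed.

Lemma column_mod i : column (i %% n) = column i.
Proof. by rewrite column.unlock modn_mod. Qed.

Lemma enum_set3 (J : {set 'I_n}) (a b c : 'I_n) : (a < b < c)%N ->
  (forall x, x \in J = [|| x == a, x == b | x == c]) -> enum J = [:: a; b; c].
Proof.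
move=> /andP[ab bc] HJ.
apply: (@irr_sorted_eq _ (fun x y : 'I_n => x < y)%N).
- by move=> x y z; apply: ltn_trans.
- by move=> x; rewrite ltnn.
- rewrite -[sorted _ _]/(sorted (relpre (@nat_of_ord n) ltn) _) -sorted_map.
  apply: (subseq_sorted ltn_trans _ (iota_ltn_sorted 0 n)).
  by rewrite -val_enum_ord map_subseq // enumT filter_subseq.
- by rewrite /= ab bc.
- by move=> x; rewrite mem_enum HJ !inE.
Qed.

Definition bracket (i j k : nat) : M := vol (column i) (column j) (column k).

Lemma plucker3 (J : {set 'I_n}) (a b c : nat) : (a < b < c)%N -> (c < n)%N ->
  (forall x : 'I_n, x \in J = [|| x == a :> nat, x == b :> nat | x == c :> nat]) ->
  plucker K 3 J = bracket a b c.
Proof.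
move=> abc cn HJ.
have [bn an] : (b < n)%N /\ (a < n)%N by split; lia.
rewrite /plucker (@enum_set3 J (Ordinal an) (Ordinal bn) (Ordinal cn)) //.
rewrite /bracket volE -det_tr /volume; congr (\det _); apply/matrixP => i j.
rewrite !mxE.
rewrite (columnE (Ordinal an)) (columnE (Ordinal bn)) (columnE (Ordinal cn)).
case: i => [[|[|[|i]]] li] //=; rewrite !mxE //.
Qed.

Section Substitution.
Variables (B : comNzRingType) (f : {rmorphism K -> B}) (Y : nat -> 'rV[B]_3).

Definition subst_var (k : 'I_(3 * n)) : B := mxvec (\matrix_(a, c) Y (val (c : 'I_n)) 0 a) 0 k.

Definition substitution (p : M) : B := mmap f subst_var p.

HB.instance Definition _ := GRing.RMorphism.copy substitution (mmap f subst_var).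

Lemma substitution_column i : (i < n)%N ->
  map_mx substitution (column i) = Y i.
Proof.
move=> ni; rewrite (columnE (Ordinal ni)); apply/rowP => a; rewrite !mxE.
by rewrite /substitution mmapX mmap1U /subst_var mxvecE mxE.
Qed.
End Substitution.
End Columns.

(** * Seeds on the rectangles *)

Section Codes.
Variables (n : nat) (hn : (3 <= n)%N).
Local Notation N := (n - 3)%N.
Local Notation Q := (rect_vertex 3 n).

Definition code (u : Q) : nat * nat :=
  if u is Some (r, j) then (val r, (N - j.+1)%N) else (0%N, N).

Lemma code_inj : injective code.
Proof.
move=> [[r j]|] [[r' j']|] //= [].
- move=> /val_inj -> E; congr (Some (_, _)); apply: val_inj => /=.
  by have := ltn_ord j; have := ltn_ord j'; lia.
- by move=> _; have := ltn_ord j; lia.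
- by move=> _; have := ltn_ord j'; lia.
Qed.

Lemma codeP u : code_ok N (code u).
Proof.
case: u => [[r j]|]; rewrite /code_ok /=; last by rewrite eqxx orbT.
by rewrite ltn_ord; have := ltn_ord j; lia.
Qed.

Lemma code_surj c : code_ok N c -> exists u, code u = c.
Proof.
case: c => r i; rewrite /code_ok /= => /orP[/andP[r3 iN]|/andP[/eqP -> /eqP ->]].
  have lj : (N - i.+1 < N)%N by lia.
  by exists (Some (Ordinal r3, Ordinal lj)) => /=; congr (_, _); lia.
by exists None.
Qed.

Definition decode c : Q := odflt None [pick u | code u == c].

Lemma decodeK c : code_ok N c -> code (decode c) = c.
Proof.
rewrite /decode; case: pickP => [u /eqP //|nu] /code_surj [u E].
by have := nu u; rewrite E eqxx.
Qed.

Lemma codeK u : decode (code u) = u.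
Proof. by apply: code_inj; rewrite decodeK ?codeP. Qed.

Lemma rect_frozenE u : rect_frozen u = code_frozen N (code u).
Proof.
case: u => [[r j]|]; rewrite /code_frozen /=; last by rewrite eqxx !orbT.
by have := ltn_ord j; rewrite !eqSS; lia.
Qed.

Lemma rect_arrowE u v : ~~ (rect_frozen u && rect_frozen v) ->
  rect_arrow u v = quiver1 N 0 (code u) (code v).
Proof.
case: u => [[r j]|]; case: v => [[s k]|] //=; rewrite ?andbF.
- move=> fuv; rewrite (negPf fuv) /=.
  have := ltn_ord j; have := ltn_ord k; have := ltn_ord r; have := ltn_ord s.
  case: r fuv => [[|[|[|r]]] lr] //=; case: s => [[|[|[|s]]] ls] //=; rewrite ?eqSS; lia.
- have := ltn_ord j; have := ltn_ord r.
  by case: r => [[|[|[|r]]] lr] //=; lia.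
- have := ltn_ord k; have := ltn_ord s.
  by case: s => [[|[|[|s]]] lr] //=; lia.
Qed.

Variable K : fieldType.
Local Notation M := (matrix_poly K 3 n).
Local Notation F := (matrix_frac K 3 n).
Local Notation column := (column K n).
Local Notation bracket := (bracket K n).

Definition rect_bracket (c : nat * nat) : M :=
  match c.1 with
  | 0 => bracket c.2 N.+1 N.+2
  | 1 => bracket c.2 c.2.+1 N.+2
  | _ => bracket c.2 c.2.+1 c.2.+2
  end.

Lemma plucker_rect u : plucker K 3 (rect_columns u) = rect_bracket (code u).
Proof.
case: u => [[r j]|] /=.
  have lj := ltn_ord j.
  rewrite /rect_bracket /=; case: r => [[|[|[|r]]] lr] //=; apply: plucker3; try lia;
    move=> x; have lx := ltn_ord x; rewrite !inE /=; lia.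
by rewrite /rect_bracket /=; apply: plucker3; try lia;
    move=> x; have lx := ltn_ord x; rewrite !inE /=; lia.
Qed.

Definition code_seed (x : nat * nat -> M) (A : nat * nat -> nat * nat -> nat) :
    seed F Q :=
  Seed (fun u => tofrac (x (code u))) (fun u v => A (code u) (code v))
       (@rect_frozen 3 n).

Local Notation Sigma := (rectangles_seed K 3 n).

(** [T] is a reachable seed up to arrows between frozen vertices, which the closed formulas
    [quiver1] and [quiver2] leave out. *)
Definition reached (T : seed F Q) : Prop :=
  exists2 S, mutation_equivalent Sigma S & embeds eq T S id.

Lemma prod_code (R : comPzRingType) (G : nat * nat -> R) (s : seq (nat * nat)) :
  all (code_ok N) s -> \prod_u G (code u) ^+ count_mem (code u) s = \prod_(c <- s) G c.
Proof.
move=> /allP oks; transitivity (\prod_(c <- map code (map decode s)) G c).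
  rewrite big_map -[RHS]prod_count; apply: eq_bigr => u _; congr (_ ^+ _).
  rewrite count_map; apply: eq_in_count => c cs /=.
  by rewrite -(inj_eq code_inj) decodeK ?oks.
by congr (bigop _ _ _); rewrite -map_comp -[RHS]map_id; apply/eq_in_map => c /oks /decodeK.
Qed.

Lemma embeds_code_seed x A x' A' :
  (forall c, code_ok N c -> x' c = x c) ->
  (forall c d, code_ok N c -> code_ok N d -> ~~ (code_frozen N c && code_frozen N d) ->
     A c d = A' c d) ->
  embeds eq (code_seed x A) (code_seed x' A') id.
Proof.
move=> Ex EA; split=> //=.
- by move=> v; rewrite Ex ?codeP.
- by move=> v u; rewrite !rect_frozenE -negb_and => fvu; rewrite EA ?codeP.
- by move=> v u' _ /(_ u'); rewrite eqxx.
- by move=> v u' _ /(_ u'); rewrite eqxx.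
Qed.

Lemma reached_sub T T' : reached T -> embeds eq T' T id -> reached T'.
Proof. by move=> [S ES E] E'; exists S => //; apply: (embeds_comp E' E). Qed.

Lemma reached_rect : reached (code_seed rect_bracket (fun c d => quiver1 N 0 c d)).
Proof.
exists Sigma; first exact: Mut_refl.
split=> //=.
- by move=> v; rewrite plucker_rect.
- by move=> v u; rewrite -negb_and => fvu; rewrite rect_arrowE.
- by move=> v u' _ /(_ u'); rewrite eqxx.
- by move=> v u' _ /(_ u'); rewrite eqxx.
Qed.

Hypothesis Sigma_neq0 : forall S v, mutation_equivalent Sigma S -> variable S v != 0.

(** Listing the neighbours with multiplicity as [outs] and [ins] reduces the change of variables to
    one identity of polynomials. *)
Lemma reached_mutate x A x' A' m (outs ins : seq (nat * nat)) :
  reached (code_seed x A) -> code_ok N m -> ~~ code_frozen N m ->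
  (forall c d, code_ok N c -> code_ok N d -> ~~ (code_frozen N c && code_frozen N d) ->
     mutate_fun A m c d = A' c d) ->
  all (code_ok N) outs -> all (code_ok N) ins ->
  (forall c, code_ok N c -> A m c = count_mem c outs) ->
  (forall c, code_ok N c -> A c m = count_mem c ins) ->
  (forall c, code_ok N c -> c != m -> x' c = x c) ->
  x' m * x m = \prod_(c <- outs) x c + \prod_(c <- ins) x c ->
  reached (code_seed x' A').
Proof.
move=> [S ES E] okm fm EA oko oki Eo Ei Ex Em.
have fm' : ~~ frozen (code_seed x A) (decode m) by rewrite /= rect_frozenE decodeK.
have nz := Sigma_neq0 (decode m) ES.
have E' := embeds_mutate (field_rel_eq F) E fm' nz.
exists (mutate S (decode m)).
  by apply: Mut_step => //; apply: embeds_mutable E _ fm'.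
apply: (embeds_comp _ E'); split=> //=.
- move=> v; rewrite /mutate_variable /=.
  have [->|vm] := eqVneq v (decode m); last first.
    rewrite Ex ?codeP //; apply: contra_neq vm => <-; by rewrite codeK.
  have xm : tofrac (x m) != 0.
    have Ev : tofrac (x (code (decode m))) = variable S (decode m).
      exact: (embeds_variable E).
    rewrite (decodeK okm) in Ev.
    rewrite Ev.
    exact: nz.
  rewrite decodeK //; apply: (canRL (mulfK xm)).
  rewrite -rmorphM /= Em rmorphD /= !rmorph_prod /=; congr (_ + _).
    rewrite -(prod_code (fun c => tofrac (x c)) oko).
    by apply: eq_bigr => u _; rewrite Eo ?codeP.
  rewrite -(prod_code (fun c => tofrac (x c)) oki).
  by apply: eq_bigr => u _; rewrite Ei ?codeP.
- move=> v u; rewrite !rect_frozenE -negb_and => fvu; rewrite -EA ?codeP //.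
  rewrite /mutate_arrows /premutate_arrows /mutate_fun /= decodeK //.
  by rewrite -!(inj_eq code_inj) !decodeK.
- by move=> v u' _ /(_ u'); rewrite eqxx.
- by move=> v u' _ /(_ u'); rewrite eqxx.
Qed.

End Codes.

(** * Rotation *)

Lemma prod_seq2 (R : comPzRingType) (I : Type) (G : I -> R) a b :
  \prod_(c <- [:: a; b]) G c = G a * G b.
Proof. by rewrite !big_cons big_nil mulr1. Qed.

Lemma prod_seq3 (R : comPzRingType) (I : Type) (G : I -> R) a b c :
  \prod_(c <- [:: a; b; c]) G c = G a * G b * G c.
Proof. by rewrite !big_cons big_nil mulr1 mulrA. Qed.

Ltac nbrs := case=> [[|[|[|?]]] ?]; rewrite /code_ok //= ?xpair_eqE /= => ?; lia.

Section Rotation.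
Variables (K : fieldType) (n : nat) (hn : (3 <= n)%N).
Local Notation N := (n - 3)%N.
Local Notation Q := (rect_vertex 3 n).
Local Notation M := (matrix_poly K 3 n).
Local Notation F := (matrix_frac K 3 n).
Local Notation column := (column K n).
Local Notation bracket := (bracket K n).
Local Notation Sigma := (rectangles_seed K 3 n).
Local Notation rect_bracket := (rect_bracket n K).
Hypothesis Sigma_neq0 : forall S v, mutation_equivalent Sigma S -> variable S v != 0.

Definition bracket1 t (c : nat * nat) : M :=
  if (c.1 == 0%N) && (0 < c.2 <= t)%N then bracket 0 c.2.+1 N.+2 else rect_bracket c.

Definition bracket2 t (c : nat * nat) : M :=
  if (c.1 == 1%N) && (0 < c.2 <= t)%N then bracket 0 c.2.+1 c.2.+2 else bracket1 N.-1 c.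

(** The exchange at [(0, t.+1)] is the three-term Plücker relation for the columns 0, t+1, t+2, N+1,
    with N+2 in common. *)
Lemma reached1 t : (t < N)%N ->
  reached (code_seed (bracket1 t) (fun c d => quiver1 N t c d)).
Proof.
elim: t => [|t IH] tN.
  apply: reached_sub (reached_rect hn K) _; apply: (embeds_code_seed hn) => // c _.
  by rewrite /bracket1; case: ifP => //; lia.
pose prev := if t == 0%N then (1%N, 0%N) else (0%N, t).
have Eprev : bracket1 t prev = bracket 0 t.+1 N.+2.
  by rewrite /prev /bracket1; case: (eqVneq t 0%N) => [->|t0] //=; rewrite leqnn ifT //; lia.
apply: (@reached_mutate _ hn _ Sigma_neq0 _ _ _ _ (0%N, t.+1) [:: (0%N, 0%N); (1%N, t.+1)]
  [:: (0%N, t.+2); prev]) (IH _) _ _ (quiver1_step tN) _ _ _ _ _ _.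
- lia.
- rewrite /code_ok /=; lia.
- rewrite /code_frozen /=; lia.
- rewrite /code_ok /=; lia.
- rewrite /prev /code_ok; case: eqP => /= ?; lia.
- nbrs.
- rewrite /prev; case: eqP => ?; nbrs.
- case=> r i _; rewrite xpair_eqE /bracket1 /= => E.
  by congr (if _ then _ else _); lia.
- rewrite !prod_seq2 Eprev /bracket1 /= leqnn ltnn [(t.+1 < t)%N]ltnNge leqnSn /=.
  by rewrite /rect_bracket /= /bracket !volE !volumeE; ring.
Qed.

(** Here the relation is for the columns 0, t+1, t+3, N+2, with t+2 in common. *)
Lemma reached2 t : (1 < N)%N -> (t < N)%N ->
  reached (code_seed (bracket2 t) (fun c d => quiver2 N t c d)).
Proof.
move=> N1; elim: t => [|t IH] tN.
  apply: reached_sub (@reached1 N.-1 _) _; first lia.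
  apply: (embeds_code_seed hn) => [c _|c d oc od fcd]; last by rewrite quiver12.
  by rewrite /bracket2; case: ifP => //; lia.
pose prev := if t == 0%N then (2, 0%N) else (1%N, t).
have Eprev : bracket2 t prev = bracket 0 t.+1 t.+2.
  by rewrite /prev /bracket2; case: (eqVneq t 0%N) => [->|t0] //=; rewrite leqnn ifT //; lia.
(* The second row has no column [N]; the bracket of N, N+1, N+2 is at [(0, N)] instead. *)
pose next := if t.+2 == N then (0%N, N) else (1%N, t.+2).
have Enext : bracket2 t next = bracket t.+2 t.+3 N.+2.
  rewrite /next /bracket2; case: (eqVneq t.+2 N) => [->|t0] //=; last first.
    by rewrite ifF; [rewrite /bracket1 | lia].
  by rewrite /bracket1 /= ifF //; lia.
apply: (@reached_mutate _ hn _ Sigma_neq0 _ _ _ _ (1%N, t.+1) [:: (0%N, t.+1); (2, t.+1)]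
  [:: next; prev]) (IH _) _ _ (quiver2_step tN) _ _ _ _ _ _.
- lia.
- rewrite /code_ok /=; lia.
- rewrite /code_frozen /=; lia.
- rewrite /code_ok /=; lia.
- rewrite /next /prev /code_ok; case: (eqVneq t.+2 N) => ?; case: (eqVneq t 0%N) => ? /=; lia.
- nbrs.
- rewrite /prev /next; case: (eqVneq t.+2 N) => ?; case: (eqVneq t 0%N) => ?; nbrs.
- case=> r i _; rewrite xpair_eqE /bracket2 /= => E.
  by congr (if _ then _ else _); lia.
- rewrite !prod_seq2 Eprev Enext /bracket2 /bracket1 /= leqnn ltnn.
  have -> : (t < N.-1)%N by lia.
  by rewrite /rect_bracket /= /bracket !volE !volumeE; ring.
Qed.

Definition rotation_hom : {rmorphism M -> M} :=
  substitution (@mpolyC (3 * n) K) (fun i => column i.+1).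

Lemma rotation_column i : map_mx rotation_hom (column i) = column i.+1.
Proof.
have n0 : (0 < n)%N by lia.
have E : (i %% n).+1 = i.+1 %[mod n] by rewrite -addn1 modnDml addn1.
by rewrite -column_mod substitution_column ?ltn_pmod // -column_mod E column_mod.
Qed.

Lemma rotation_bracket i j k :
  rotation_hom (bracket i j k) = bracket i.+1 j.+1 k.+1.
Proof. by rewrite /bracket !volE volume_map !rotation_column. Qed.

Lemma rot_code_ok c : (1 < N)%N -> code_ok N c -> code_ok N (rot_code N c).
Proof.
move=> N1; case: c => [[|[|[|r]]] i]; rewrite /code_ok /rot_code //=;
  do ![case: ifP => //= ?]; lia.
Qed.

Lemma rot_code_inj c d : (1 < N)%N -> code_ok N c -> code_ok N d ->
  rot_code N c = rot_code N d -> c = d.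
Proof.
move=> N1; case: c => [[|[|[|r]]] i]; case: d => [[|[|[|s]]] j]; rewrite /code_ok /rot_code //=;
  do ![case: ifP => //= ?] => ? ? /eqP; rewrite xpair_eqE => ?; apply/eqP; rewrite xpair_eqE; lia.
Qed.

Lemma rot_code_frozen c : (1 < N)%N -> code_ok N c -> ~~ code_frozen N c ->
  ~~ code_frozen N (rot_code N c).
Proof.
move=> N1; case: c => [[|[|[|r]]] i]; rewrite /code_ok /code_frozen /rot_code //=;
  do ![case: ifP => //= ?]; lia.
Qed.

Lemma bracket_rot i j k : bracket i j k = bracket j k i.
Proof. by rewrite /bracket !volE volume_rot. Qed.

Lemma bracket_mod i j k : bracket i j (k + n) = bracket i j k.
Proof. by rewrite /bracket -(column_mod K n (k + n)) modnDr column_mod. Qed.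

(** A cyclic permutation of three columns is even, so wrapped brackets return to increasing order
    without a sign. *)
Lemma rotation_rect c : (1 < N)%N -> code_ok N c ->
  rotation_hom (rect_bracket c) = bracket2 N.-1 (rot_code N c).
Proof.
have EN : N.+3 = (0 + n)%N by lia.
move=> N1; case: c => [[|[|[|r]]] i]; rewrite /code_ok //= => ok;
  rewrite /rect_bracket /= rotation_bracket ?EN ?bracket_mod.
- rewrite /rot_code /=; case: (eqVneq i 0%N) => [->|i0] /=.
    rewrite /bracket2 /bracket1 /rect_bracket /=.
    by rewrite (bracket_rot 0) (bracket_rot 1).
  case: (eqVneq i N) => [->|iN].
    rewrite /bracket2 /bracket1 /rect_bracket /=.
    by rewrite -(bracket_rot 0).
  rewrite /bracket2 /bracket1 /= ifT; last lia.
  by rewrite -(bracket_rot 0).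
- rewrite /rot_code /=; case: (eqVneq i 0%N) => [->|i0] /=.
    rewrite /bracket2 /bracket1 /rect_bracket /=.
    by rewrite -(bracket_rot 0).
  case: (eqVneq i N) => [E|iN]; first lia.
  rewrite /bracket2 /= ifT; last lia.
  by rewrite -(bracket_rot 0).
- rewrite /rot_code /=; case: (eqVneq i N.-1) => [->|i0] /=.
    rewrite /bracket2 /bracket1 /rect_bracket /= ifF; last lia.
    by congr bracket; lia.
  by rewrite /bracket2 /bracket1 /rect_bracket /=.
Qed.

Lemma seed_variable_rotation z : (1 < N)%N ->
  seed_variable Sigma (tofrac z) -> seed_variable Sigma (tofrac (rotation_hom z)).
Proof.
move=> N1 [S ES [v Ez]].
have [S1 ES1 E1] : reached (code_seed (bracket2 N.-1) (fun c d => quiver2 N N.-1 c d)).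
  by apply: reached2; lia.
have Erot : embeds (frac_rel rotation_hom) Sigma
    (code_seed (bracket2 N.-1) (fun c d => quiver2 N N.-1 c d))
    (fun u => decode n (rot_code N (code u))).
  have codeE (u : Q) : code (decode n (rot_code N (code u))) = rot_code N (code u).
    by apply: decodeK => //; apply: rot_code_ok => //; apply: codeP.
  have inj : injective (fun u : Q => decode n (rot_code N (code u))).
    move=> u v' /(congr1 (@code n)); rewrite !codeE => /(rot_code_inj N1 (codeP hn u) (codeP hn v')).
    exact: code_inj.
  split=> //=.
  - move=> u; rewrite codeE -rotation_rect ?codeP // -plucker_rect //.
    exact: frac_rel_tofrac.
  - by move=> u; rewrite !rect_frozenE // codeE ; apply: rot_code_frozen => //; apply: codeP.
  - move=> u w fuw; rewrite !codeE rect_arrowE ?negb_and //.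
    by rewrite quiver_rot ?codeP // negb_and -!rect_frozenE.
  (* An injective self-map of a finite set is onto: there are no vertices outside of the image. *)
  - by move=> u w fu /(_ (invF inj w)); have /= -> := f_invF inj w; rewrite eqxx.
  - by move=> u w fu /(_ (invF inj w)); have /= -> := f_invF inj w; rewrite eqxx.
have E := embeds_comp Erot E1.
have nz1 S' w : mutation_equivalent S1 S' -> variable S' w != 0.
  by move=> /(mutation_equivalent_trans ES1); apply: Sigma_neq0.
have [S' ES' E'] := embeds_equivalent (frac_rel_field _) nz1 E ES.
exists S'; first exact: mutation_equivalent_trans ES1 ES'.
eexists; symmetry; apply: frac_rel_fun; rewrite Ez; exact: (embeds_variable E' v).
Qed.
End Rotation.

(** * Promotion *)

Section PromotionIdentities.
Variables (A : comNzRingType) (e0 e1 e2 e3 : 'rV[A]_3).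
Let w := cross (cross e0 e1) (cross e2 e3).
Implicit Types a b p q : 'rV[A]_3.

Let wE a b : vol w a b = vol e0 e1 e3 * vol e2 a b - vol e0 e1 e2 * vol e3 a b.
Proof. by rewrite !volE /w cross_cross volume_lin. Qed.

(** The four identities are the exchange relations at [(1, 1)], [(0, 2)], [(0, 3)], [(1, 3)], in
    this order. There [e0], ..., [e3] are the columns 0 to 3, [p] and [q] the columns N+1 and N+2,
    [a] and [b] the columns 4 and 5. *)
Lemma crossing_exchange1 p q : vol w p q * vol e1 e2 q =
  vol e2 p q * vol e0 e1 q * vol e1 e2 e3 + vol e1 p q * vol e2 e3 q * vol e0 e1 e2.
Proof. rewrite wE. by rewrite !volE !volumeE; ring. Qed.

Lemma crossing_exchange2 p q : vol e0 e1 e3 * vol e2 p q =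
  vol w p q + vol e3 p q * vol e0 e1 e2.
Proof. by rewrite wE; ring. Qed.

Lemma crossing_exchange3 a p q : vol w a q * vol e3 p q =
  vol w p q * vol e3 a q + vol e0 e1 e3 * vol a p q * vol e2 e3 q.
Proof. rewrite !wE. by rewrite !volE !volumeE; ring. Qed.

Lemma crossing_exchange4 a b q : vol w a b * vol e3 a q =
  vol w a q * vol e3 a b + vol e0 e1 e3 * vol a b q * vol e2 e3 a.
Proof. rewrite !wE. by rewrite !volE !volumeE; ring. Qed.
End PromotionIdentities.

Section PromotedQuiver.
Local Open Scope nat_scope.
Variable k : nat.
Implicit Types c d m : nat * nat.

Let A0 c d : nat := quiver1 (6 + k) 0 c d.

(** The mutations at [(1, 1)], [(0, 3)], [(1, 3)] create the three variables containing the new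
    vector. The one at [(0, 2)] is auxiliary: it creates the bracket of 0, 1, 3, which enters the
    last two exchange relations. *)
Definition promoted_quiver : nat * nat -> nat * nat -> nat :=
  foldl mutate_fun A0 [:: (1, 1); (0, 2); (0, 3); (1, 3)].

Lemma quiver_far c d : c.2 < 4 -> 5 < d.2 -> A0 c d = 0 /\ A0 d c = 0.
Proof.
case: c => [[|[|[|r]]] i]; case: d => [[|[|[|s]]] j]; rewrite /A0 /=; lia.
Qed.

(** There are no 2-cycles, so the truncated subtraction alone changes nothing. *)
Lemma quiver_acyclic c d : A0 c d - A0 d c = A0 c d.
Proof.
case: c => [[|[|[|r]]] i]; case: d => [[|[|[|s]]] j]; rewrite /A0 //=.
all: solve [repeat split_atom].
Qed.

(** The mutated vertices have columns below 4, and no arrow joins these to columns beyond 5. Arrows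
    touching the latter thus never change, and a window of fixed size remains to be computed. *)
Definition far A := forall c d, (5 < c.2) || (5 < d.2) -> A c d = A0 c d.

Lemma far_mutate A m : m.2 < 4 -> far A -> far (mutate_fun A m).
Proof.
move=> m4 fA c d cd; rewrite /mutate_fun orbC.
have fAm e : 5 < e.2 -> A m e = 0 /\ A e m = 0.
  by move=> e5; rewrite !fA ?e5 ?orbT //; apply: quiver_far.
case: ifP => [/orP[/eqP E|/eqP E]|_].
- have c5 : 5 < c.2 by move: cd; rewrite E; lia.
  by rewrite E; have [-> ->] := fAm c c5; have [_ ->] := quiver_far m4 c5.
- have d5 : 5 < d.2 by move: cd; rewrite E; lia.
  by rewrite E; have [-> ->] := fAm d d5; have [-> _] := quiver_far m4 d5.
- have [-> ->] : A c m * A m d = 0 /\ A d m * A m c = 0.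
    by case/orP: cd => /fAm[-> ->]; rewrite ?mul0n ?muln0.
  by rewrite !addn0 !fA ?[X in _ || X]cd ?quiver_acyclic // orbC.
Qed.

Lemma promoted_far : far promoted_quiver.
Proof. by do 4!apply: far_mutate => //. Qed.

Definition window i := [seq (r, j) | r <- iota 0 3, j <- iota 0 i].

Lemma windowP i c : c.1 < 3 -> c.2 < i -> c \in window i.
Proof.
by case: c => r j /= r3 ji; apply/allpairsP; exists (r, j); rewrite !mem_iota.
Qed.

(** The smaller brackets that contain the first column are those in column 0; they go to mutated
    vertices, and all others move by three columns. *)
Definition promoted_code c : nat * nat :=
  if c.2 == 0 then nth (0, 0) [:: (1, 1); (0, 3); (1, 3)] c.1 else (c.1, c.2 + 3).

Lemma promoted_arrows c d : code_ok (3 + k) c -> code_ok (3 + k) d ->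
  ~~ (code_frozen (3 + k) c && code_frozen (3 + k) d) ->
  promoted_quiver (promoted_code c) (promoted_code d) = quiver1 (3 + k) 0 c d.
Proof.
move=> okc okd fcd.
have [far_cd|] := boolP ((2 < c.2) || (2 < d.2)).
  rewrite promoted_far; last first.
    rewrite /promoted_code; case/orP: far_cd => l2.
      by rewrite [c.2 == 0]gtn_eqF /= ?l2; lia.
    by rewrite [d.2 == 0]gtn_eqF /= ?l2; lia.
  move: okc okd fcd far_cd; rewrite /A0 /code_ok /code_frozen /promoted_code.
  case: c => [[|[|[|r]]] [|i]]; case: d => [[|[|[|s]]] [|j]] //=; lia.
rewrite negb_or -!leqNgt => /andP[lc ld].
have [c3 d3] : c.1 < 3 /\ d.1 < 3 by move: okc okd; rewrite /code_ok; lia.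
apply/eqP; move: fcd; apply/implyP.
have cw := @windowP 3 c c3 lc; have dw := @windowP 3 d d3 ld.
move: {okc okd lc ld c3 d3} d dw; apply/allP; move: c cw; apply/allP.
(* The successors in front of [k] decide the comparisons with the columns of the window, so one
   finite computation serves all [k]. *)
by vm_compute.
Qed.

Lemma neighbours_window A m (outs ins : seq (nat * nat)) : far A -> m.2 < 4 ->
  all (fun c => c.2 < 6) (outs ++ ins) ->
  all (fun c => (A m c == count_mem c outs) && (A c m == count_mem c ins)) (window 6) ->
  forall c, c.1 < 3 -> A m c = count_mem c outs /\ A c m = count_mem c ins.
Proof.
rewrite all_cat => fA m4 /andP[/allP oko /allP oki] /allP win c c3.
have [c6|c6] := ltnP c.2 6; first by have /andP[/eqP-> /eqP->] := win _ (windowP c3 c6).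
rewrite !fA ?c6 ?orbT //; have [-> ->] := quiver_far m4 c6.
by split; apply/esym/count_memPn; apply: contraL c6; [move/oko|move/oki]; rewrite -leqNgt.
Qed.

Lemma promoted_outside c d : code_ok (3 + k) c -> ~~ code_frozen (3 + k) c ->
  code_ok (6 + k) d -> (forall e, code_ok (3 + k) e -> d != promoted_code e) ->
  promoted_quiver (promoted_code c) d = 0 /\ promoted_quiver d (promoted_code c) = 0.
Proof.
move=> okc fc okd dn.
(* From column 4 on, every vertex is the image of the one three columns before it. *)
have d4 : d.2 < 4.
  rewrite ltnNge; apply/negP => d4.
  have: code_ok (3 + k) (d.1, d.2 - 3) by move: okd; rewrite /code_ok /=; lia.
  move/dn/eqP; apply; rewrite /promoted_code /= subn_eq0 leqNgt d4 subnK ?(ltnW d4) //.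
  by case: (d).
have [d11 d03 d13] : [/\ d != (1, 1), d != (0, 3) & d != (1, 3)].
  by split; [apply: (dn (0, 0))|apply: (dn (1, 0))|apply: (dn (2, 0))].
have [c1 c2] : c.1 < 2 /\ 0 < c.2.
  by move: okc fc; rewrite /code_ok /code_frozen; lia.
have [c3|c3] := ltnP 2 c.2.
  rewrite !promoted_far; try by rewrite /promoted_code gtn_eqF //=; lia.
  move: c3; rewrite /promoted_code gtn_eqF //= {d11 d03 d13 dn okd}.
  by case: c d d4 {okc fc c2} c1 => [[|[|r]] i] [[|[|[|s]]] j] //=; rewrite /A0 /=; lia.
have d3 : d.1 < 3 by move: okd; rewrite /code_ok; lia.
suff: [==> d != (1, 1), d != (0, 3), d != (1, 3), c.1 < 2, 0 < c.2 =>
        (promoted_quiver (promoted_code c) d == 0) && (promoted_quiver d (promoted_code c) == 0)].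
  by rewrite d11 d03 d13 c1 c2 /= => /andP[/eqP -> /eqP ->].
have cw := @windowP 3 c (ltnW c1) c3; have dw := @windowP 4 d d3 d4.
move: {okc fc okd dn d4 d11 d03 d13 c1 c2 c3 d3} d dw; apply/allP; move: c cw; apply/allP.
by vm_compute.
Qed.
End PromotedQuiver.

Section Promotion.
Variables (K : fieldType) (n : nat) (hn : (6 <= n)%N).
Local Notation N := (n - 3)%N.
Local Notation Q := (rect_vertex 3 n).
Local Notation M := (matrix_poly K 3 n).
Local Notation F := (matrix_frac K 3 n).
Local Notation column := (column K n).
Local Notation bracket := (bracket K n).
Local Notation Sigma := (rectangles_seed K 3 n).
Local Notation rect_bracket := (rect_bracket n K).
Hypothesis Sigma_neq0 : forall S v, mutation_equivalent Sigma S -> variable S v != 0.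

Let hn3 : (3 <= n)%N. Proof. exact: leq_trans hn. Qed.

Definition crossing : 'rV[M]_3 :=
  cross (cross (column 0) (column 1)) (cross (column 2) (column 3)).

Definition promoted1 c : M :=
  if c == (1%N, 1%N) then vol crossing (column N.+1) (column N.+2) else rect_bracket c.
Definition promoted2 c : M :=
  if c == (0%N, 2) then bracket 0 1 3 else promoted1 c.
Definition promoted3 c : M :=
  if c == (0%N, 3) then vol crossing (column 4) (column N.+2) else promoted2 c.
Definition promoted4 c : M :=
  if c == (1%N, 3) then vol crossing (column 4) (column 5) else promoted3 c.

Lemma reached_promoted1 :
  reached (code_seed promoted1 (mutate_fun (fun c d => quiver1 N 0 c d) (1, 1))).
Proof.
apply: (@reached_mutate _ hn3 _ Sigma_neq0 _ _ _ _ (1, 1) [:: (0, 2); (1, 0); (2, 1)]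
  [:: (0, 1); (1, 2); (2, 0)]) (reached_rect hn3 K) _ _ _ _ _ _ _ _ _ => //.
- rewrite /code_ok /=; lia.
- rewrite /code_frozen /=; lia.
- rewrite /code_ok /=; lia.
- rewrite /code_ok /=; lia.
- nbrs.
- nbrs.
- by move=> c _ /negPf E; rewrite /promoted1 E.
- rewrite !prod_seq3 /promoted1 /= /rect_bracket /=.
  by rewrite crossing_exchange1.
Qed.

Section Nine.
Hypothesis hn9 : (9 <= n)%N.
Local Notation k := (n - 9)%N.
Let EN : N = (6 + k)%N. Proof. by lia. Qed.

Lemma reached_promoted : reached (code_seed promoted4 (promoted_quiver k)).
Proof.
have far0 : far k (fun c d => quiver1 (6 + k) 0 c d) by [].
have far1 := @far_mutate k _ (1, 1) isT far0.
have far2 := @far_mutate k _ (0, 2) isT far1.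
have far3 := @far_mutate k _ (0, 3) isT far2.
have c3 c : code_ok N c -> (c.1 < 3)%N by rewrite /code_ok; lia.
have R1 := reached_promoted1; rewrite EN in R1.
have step A m outs ins (x x' : nat * nat -> M) : far k A -> (m.2 < 4)%N ->
    reached (code_seed x A) -> code_ok N m -> ~~ code_frozen N m ->
    all (fun c => c.2 < 6)%N (outs ++ ins) -> all (code_ok N) outs -> all (code_ok N) ins ->
    all (fun c => (A m c == count_mem c outs) && (A c m == count_mem c ins)) (window 6) ->
    (forall c, x' c = if c == m then x' m else x c) ->
    x' m * x m = \prod_(c <- outs) x c + \prod_(c <- ins) x c ->
    reached (code_seed x' (mutate_fun A m)).
  move=> fA m4 R okm fm win oko oki W Ex Em.
  apply: (reached_mutate hn3 Sigma_neq0 R okm fm _ oko oki _ _ _ Em) => //.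
  - by move=> c /c3 /(neighbours_window fA m4 win W)[].
  - by move=> c /c3 /(neighbours_window fA m4 win W)[].
  - by move=> c _ /negPf E; rewrite Ex E.
pose A0 c d : nat := quiver1 (6 + k) 0 c d.
have R2 : reached (code_seed promoted2 (foldl mutate_fun A0 [:: (1, 1); (0, 2)])).
  apply: (step _ _ [:: (1, 1)] [:: (0, 3); (2, 0)] _ _ far1 _ R1) => //.
  - by rewrite /code_ok /=; lia.
  - by rewrite /code_frozen /=; lia.
  - by rewrite /code_ok /=; lia.
  - by rewrite /code_ok /=; lia.
  - by rewrite big_seq1 prod_seq2 /promoted2 /promoted1 /= /rect_bracket /= crossing_exchange2.
have R3 : reached (code_seed promoted3 (foldl mutate_fun A0 [:: (1, 1); (0, 2); (0, 3)])).
  apply: (step _ _ [:: (1, 1); (1, 3)] [:: (0, 2); (0, 4); (1, 2)] _ _ far2 _ R2) => //.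
  - by rewrite /code_ok /=; lia.
  - by rewrite /code_frozen /=; lia.
  - by rewrite /code_ok /=; lia.
  - by rewrite /code_ok /=; lia.
  - by rewrite prod_seq2 prod_seq3 /promoted3 /promoted2 /promoted1 /= /rect_bracket /= crossing_exchange3.
apply: (step _ _ [:: (0, 3); (2, 3)] [:: (0, 2); (1, 4); (2, 2)] _ _ far3 _ R3) => //.
- by rewrite /code_ok /=; lia.
- by rewrite /code_frozen /=; lia.
- by rewrite /code_ok /=; lia.
- by rewrite /code_ok /=; lia.
- by rewrite prod_seq2 prod_seq3 /promoted4 /promoted3 /promoted2 /promoted1 /= /rect_bracket /= crossing_exchange4.
Qed.
End Nine.
End Promotion.

Section PromotionMap.
Variables (K : fieldType) (n : nat) (hn : (6 <= n)%N).
Local Notation N := (n - 3)%N.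
Local Notation Q := (rect_vertex 3 n).
Local Notation M := (matrix_poly K 3 n).
Local Notation column := (column K n).
Local Notation Sigma := (rectangles_seed K 3 n).
Local Notation crossing := (crossing K n).
Hypothesis Sigma_neq0 : forall S v, mutation_equivalent Sigma S -> variable S v != 0.

Let hn3 : (3 <= n)%N. Proof. exact: leq_trans hn. Qed.
Let hN3 : (3 <= N)%N. Proof. by lia. Qed.

Definition promoted_column (i : nat) : 'rV[M]_3 :=
  if i == 0%N then crossing else column (i + 3).

Definition promotion_hom : {rmorphism matrix_poly K 3 N -> M} :=
  @substitution K N _ (@mpolyC (3 * n) K) promoted_column.

Lemma promotion_bracket i j l : (i < N)%N -> (j < N)%N -> (l < N)%N ->
  promotion_hom (bracket K N i j l) =
  vol (promoted_column i) (promoted_column j) (promoted_column l).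
Proof.
by move=> iN jN lN; rewrite /bracket !volE volume_map !substitution_column.
Qed.

Lemma promotion_embeds_arrows (f : rect_vertex 3 N -> Q) (g : nat * nat -> nat * nat)
    (x : nat * nat -> M) (A : nat * nat -> nat * nat -> nat) :
  (forall u, code (f u) = g (code u)) ->
  (forall u v, code_ok (N - 3)%N u -> code_ok (N - 3)%N v -> g u = g v -> u = v) ->
  (forall c, code_ok (N - 3)%N c -> promotion_hom (rect_bracket N K c) = x (g c)) ->
  (forall c, code_ok (N - 3)%N c -> ~~ code_frozen (N - 3)%N c -> ~~ code_frozen N (g c)) ->
  (forall c d, code_ok (N - 3)%N c -> code_ok (N - 3)%N d ->
    ~~ (code_frozen (N - 3)%N c && code_frozen (N - 3)%N d) ->
    A (g c) (g d) = quiver1 (N - 3)%N 0 c d) ->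
  (forall c d, code_ok (N - 3)%N c -> ~~ code_frozen (N - 3)%N c -> code_ok N d ->
    (forall e, code_ok (N - 3)%N e -> d != g e) -> A (g c) d = 0%N /\ A d (g c) = 0%N) ->
  embeds (frac_rel promotion_hom) (rectangles_seed K 3 N) (code_seed x A) f.
Proof.
move=> fg gi gx gf gA gO.
have okc u := codeP hN3 u.
split=> //=.
- by move=> u v /(congr1 (@code n)); rewrite !fg => /gi E; apply: (code_inj hN3); apply: E.
- move=> u; rewrite fg -gx ?okc // -plucker_rect //; exact: frac_rel_tofrac.
- by move=> u; rewrite !rect_frozenE // fg; apply: gf.
- move=> u v fuv; rewrite !fg rect_arrowE ?negb_and // gA ?okc //.
  by rewrite negb_and -!rect_frozenE.
- move=> v u' fv u'f; rewrite fg; apply: (proj1 (gO _ _ _ _ _ _)); rewrite ?okc -?rect_frozenE ?codeP //.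
  move=> e oke; have [w <-] := code_surj hN3 oke.
  by rewrite -fg (inj_eq (code_inj hn3)).
- move=> v u' fv u'f; rewrite fg; apply: (proj2 (gO _ _ _ _ _ _)); rewrite ?okc -?rect_frozenE ?codeP //.
  move=> e oke; have [w <-] := code_surj hN3 oke.
  by rewrite -fg (inj_eq (code_inj hn3)).
Qed.

Lemma seed_variable_embeds z T f : reached T ->
  embeds (frac_rel promotion_hom) (rectangles_seed K 3 N) T f ->
  seed_variable (rectangles_seed K 3 N) (tofrac z) ->
  seed_variable Sigma (tofrac (promotion_hom z)).
Proof.
move=> [S1 ES1 E1] ET [S ES [v Ez]].
have E := embeds_comp ET E1.
have nz1 S' w : mutation_equivalent S1 S' -> variable S' w != 0.
  by move=> /(mutation_equivalent_trans ES1); apply: Sigma_neq0.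
have [S' ES' E'] := embeds_equivalent (frac_rel_field _) nz1 E ES.
exists S'; first exact: mutation_equivalent_trans ES1 ES'.
eexists; symmetry; apply: frac_rel_fun; rewrite Ez; exact: (embeds_variable E' v).
Qed.

Lemma promoted_codeE u : (9 <= n)%N ->
  code (decode n (promoted_code (code (u : rect_vertex 3 N)))) = promoted_code (code u).
Proof.
move=> hn9; apply: decodeK => //; have := codeP hN3 u; rewrite /code_ok /promoted_code.
by case: (code u) => [[|[|[|r]]] [|i]] //=; lia.
Qed.

Lemma seed_variable_promotion z : (3 %| n)%N ->
  seed_variable (rectangles_seed K 3 N) (tofrac z) ->
  seed_variable Sigma (tofrac (promotion_hom z)).
Proof.
move=> n3; have [n9|n9] := leqP 9 n.
  have E6 : N = (6 + (n - 9))%N by lia.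
  have E3 : (N - 3 = 3 + (n - 9))%N by lia.
  have EN i : (N - 3 + i + 3 = N + i)%N by lia.
  apply: (seed_variable_embeds (reached_promoted hn Sigma_neq0 n9)).
  apply: (@promotion_embeds_arrows (fun u => decode n (promoted_code (code u))) promoted_code).
  - by move=> u; apply: promoted_codeE.
  - move=> [[|[|[|r]]] [|i]] [[|[|[|s]]] [|j]] //=; rewrite /code_ok /promoted_code //=;
      move=> ? ? /eqP; rewrite xpair_eqE => ?; apply/eqP; rewrite xpair_eqE /=; lia.
  - move=> [[|[|[|r]]] [|i]]; rewrite /code_ok //= => ok;
    rewrite /rect_bracket /= promotion_bracket ?/promoted_column /promoted_code /=; try lia.
    + by congr (vol _ (column _) (column _)); lia.
    + rewrite !addn3 /promoted4 /promoted3 /promoted2 /promoted1 /= /rect_bracket /=.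
      by congr (vol _ (column _) (column _)); lia.
    + by congr (vol _ _ (column _)); lia.
    + rewrite !addn3 /promoted4 /promoted3 /promoted2 /promoted1 /= /rect_bracket /=.
      by congr (vol _ _ (column _)); lia.
    + by [].
    + by rewrite !addn3.
  - move=> [[|[|[|r]]] [|i]]; rewrite /code_ok /code_frozen /promoted_code //=; lia.
  - by rewrite E3; apply: promoted_arrows.
  - rewrite E3 E6; exact: promoted_outside.
have E6 : n = 6%N by lia.
have only c : code_ok (N - 3)%N c -> c = (0%N, 0%N).
  by rewrite E6; case: c => [[|[|[|r]]] [|i]].
have frz c : code_ok (N - 3)%N c -> code_frozen (N - 3)%N c by move/only ->.
apply: (seed_variable_embeds (reached_promoted1 hn Sigma_neq0)).
apply: (@promotion_embeds_arrows (fun u => decode n (1%N, 1%N)) (fun=> (1%N, 1%N))).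
- by move=> u; apply: decodeK => //; rewrite /code_ok /=; lia.
- by move=> u v /only -> /only ->.
- move=> c /only ->; rewrite /rect_bracket /= promotion_bracket; try lia.
  by rewrite /promoted1 /promoted_column /= E6.
- by move=> c /frz ->.
- by move=> c d /frz -> /frz ->.
- by move=> c d /frz ->.
Qed.
End PromotionMap.

(** * Positivity *)

Section Positivity.
Variables (K : numFieldType) (n : nat) (hn : (3 <= n)%N).
Local Notation M := (matrix_poly K 3 n).

(** A point of the moment curve: brackets become Vandermonde determinants, positive for increasing
    columns. *)
Definition moment_vector (i : nat) : 'rV[K]_3 := \row_j i%:R ^+ j.

Definition moment_hom : {rmorphism M -> K} := substitution idfun moment_vector.

Lemma volume_moment i j l :
  volume (moment_vector i) (moment_vector j) (moment_vector l) =
  (j%:R - i%:R) * (l%:R - i%:R) * (l%:R - j%:R).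
Proof.
have E a k : (k < 3)%N -> entry (moment_vector a) k = a%:R ^+ k.
  by move=> k3; rewrite /entry mxE inordK.
by rewrite volumeE !E // !expr0 !expr1; ring.
Qed.

Lemma moment_bracket_gt0 i j l : (i < j < l)%N -> (l < n)%N ->
  0 < moment_hom (bracket K n i j l).
Proof.
move=> /andP[ij jl] ln; rewrite /bracket volE volume_map !substitution_column; try lia.
rewrite volume_moment !mulr_gt0 // subr_gt0 ltr_nat //.
exact: ltn_trans jl.
Qed.

Lemma rectangles_neq0 S v : mutation_equivalent (rectangles_seed K 3 n) S ->
  variable S v != 0.
Proof.
apply: (positive_neq0 (frac_pos_cone moment_hom)) => u /=.
apply: frac_pos_tofrac; rewrite plucker_rect //.
have := codeP hn u; case: (code u) => [[|[|r]] i]; rewrite /code_ok /rect_bracket /= => ok;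
  apply: moment_bracket_gt0; lia.
Qed.
End Positivity.

(** * Trees of vectors *)

(* In a web with black boundary every subtree sending a vector to its parent
   is a leaf or an inner black vertex with its two white children; the node
   has the four subtrees below these. *)
Inductive qtree := QLeaf | QNode of qtree & qtree & qtree & qtree.

Fixpoint qsize t :=
  if t is QNode a b c d then (qsize a + qsize b + qsize c + qsize d)%N else 1%N.

Section Evaluation.
Variable A : comNzRingType.
Implicit Types X Y : nat -> 'rV[A]_3.

Fixpoint qeval X t o : 'rV[A]_3 :=
  if t is QNode a b c d then
    cross (cross (qeval X a o) (qeval X b (o + qsize a)%N))
          (cross (qeval X c (o + qsize a + qsize b)%N)
                 (qeval X d (o + qsize a + qsize b + qsize c)%N))
  else X o.

Lemma qeval_ext X Y t o o' : (forall j, (j < qsize t)%N -> X (o + j)%N = Y (o' + j)%N) ->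
  qeval X t o = qeval Y t o'.
Proof.
elim: t o o' => [|a IHa b IHb c IHc d IHd] o o' /= E.
  by have := E 0%N isT; rewrite !addn0.
congr (cross (cross _ _) (cross _ _)).
- by apply: IHa => j lj; apply: E; lia.
- by apply: IHb => j lj; rewrite -!addnA E //; lia.
- by apply: IHc => j lj; rewrite -!addnA E //; lia.
- by apply: IHd => j lj; rewrite -!addnA E //; lia.
Qed.

Definition contract X p j : 'rV[A]_3 :=
  if (j < p)%N then X j
  else if j == p then cross (cross (X p) (X p.+1)) (cross (X p.+2) (X p.+3))
  else X (j + 3)%N.

Fixpoint qevals X s o : seq 'rV[A]_3 :=
  if s is t :: s' then qeval X t o :: qevals X s' (o + qsize t)%N else [::].

Definition qsizes s : nat := sumn (map qsize s).

Lemma qevals_ext X Y s o o' : (forall j, (j < qsizes s)%N -> X (o + j)%N = Y (o' + j)%N) ->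
  qevals X s o = qevals Y s o'.
Proof.
elim: s o o' => //= t s IH o o' E; congr (_ :: _).
  by apply: qeval_ext => j lj; apply: E; rewrite /qsizes /=; lia.
by apply: IH => j lj; rewrite -!addnA E // /qsizes /=; move: lj; rewrite /qsizes; lia.
Qed.
End Evaluation.

Lemma qeval_map (A B : comNzRingType) (phi : {rmorphism A -> B}) X t o :
  map_mx phi (qeval X t o) = qeval (fun i => map_mx phi (X i)) t o.
Proof.
by elim: t o => //= a IHa b IHb c IHc d IHd o; rewrite !cross_map IHa IHb IHc IHd.
Qed.

Lemma qsize_mod3 t : (qsize t %% 3 = 1)%N.
Proof. by elim: t => //= a Ha b Hb c Hc d Hd; lia. Qed.

Lemma qsize_gt0 t : (0 < qsize t)%N.
Proof. by have := qsize_mod3 t; case: (qsize t). Qed.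

Definition qleaf t := if t is QLeaf then true else false.

Definition contractible t := forall A : comNzRingType, exists k t',
  [/\ (k < qsize t')%N, qsize t = (qsize t' + 3)%N
    & forall (X : nat -> 'rV[A]_3) o, qeval X t o = qeval (contract X (o + k)) t' o].

Lemma contract_before (A : comNzRingType) (X : nat -> 'rV[A]_3) p j :
  (j < p)%N -> contract X p j = X j.
Proof. by rewrite /contract => ->. Qed.

Lemma contract_after (A : comNzRingType) (X : nat -> 'rV[A]_3) p j :
  (p < j)%N -> contract X p j = X (j + 3)%N.
Proof. by move=> pj; rewrite /contract ltnNge (ltnW pj) /= gtn_eqF. Qed.

(** Lists serve both the four subtrees of a node and the three trees of a web. The hypothesis is a
    conjunction over the list, to be filled with the induction hypotheses for the subtrees. *)
Lemma contract_forest (A : comNzRingType) s :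
  foldr (fun t P => (~~ qleaf t -> contractible t) /\ P) True s -> ~~ all qleaf s ->
  exists k s', [/\ size s' = size s, (k < qsizes s')%N, qsizes s = (qsizes s' + 3)%N
    & forall (X : nat -> 'rV[A]_3) o, qevals X s o = qevals (contract X (o + k)) s' o].
Proof.
elim: s => //= t s IH [ct cs]; rewrite negb_and; case: (boolP (qleaf t)) => [lt /= ns|nt _].
  have [k [s' [ss ks Es Ev]]] := IH cs ns.
  exists (qsize t + k)%N, (t :: s'); split; rewrite /= ?ss //.
  - by rewrite /qsizes /=; move: ks; rewrite /qsizes; lia.
  - by rewrite /qsizes /=; move: Es; rewrite /qsizes; lia.
  - move=> X o; rewrite Ev addnA; congr (_ :: _).
    by apply: qeval_ext => j lj; rewrite contract_before //; lia.
have [k [t' [kt Et Ev]]] := ct nt A.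
exists k, (t' :: s); split; rewrite //= ?/qsizes /=; try lia.
move=> X o; rewrite Ev; congr (_ :: _).
apply: qevals_ext => j _; rewrite contract_after; last by lia.
by congr X; lia.
Qed.

Lemma qtree_contractible t : ~~ qleaf t -> contractible t.
Proof.
elim: t => //= a IHa b IHb c IHc d IHd _ A.
have [|ns] := boolP (all qleaf [:: a; b; c; d]).
  case: a {IHa} => //; case: b {IHb} => //; case: c {IHc} => //; case: d {IHd} => // _.
  exists 0%N, QLeaf; split=> // X o; rewrite /contract /= addn0 ltnn eqxx.
  by rewrite -!addnA !addn1 !addnS addn0.
have [//|k [s' [ss ks Es Ev]]] := @contract_forest A [:: a; b; c; d] _ ns.
case: s' ss ks Es Ev => [|a' [|b' [|c' [|d' [|]]]]] // _ ks Es Ev.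
exists k, (QNode a' b' c' d'); split.
- by move: ks; rewrite /qsizes /=; lia.
- by move: Es; rewrite /qsizes /=; lia.
- by move=> X o; have [/= -> -> -> ->] := Ev X o.
Qed.

(** * Membership in the coordinate ring *)

Section CoordinateRing.
Variables (K : fieldType) (n : nat) (n0 : (0 < n)%N).
Local Notation M := (matrix_poly K 3 n).
Local Notation ring := (@in_coordinate_ring K 3 n).
Local Notation column := (column K n).
Implicit Types x y : M.

Lemma coordN x : ring x -> ring (- x).
Proof.
move=> rx; have -> : - x = (-1)%:MP * x by rewrite mpolyCN mpolyC1 mulN1r.
by apply: Coord_mul => //; apply: Coord_const.
Qed.

Lemma coordB x y : ring x -> ring y -> ring (x - y).
Proof. by move=> rx ry; apply: Coord_add => //; apply: coordN. Qed.

Lemma coord0 : ring 0.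
Proof. by rewrite -mpolyC0; apply: Coord_const. Qed.

Lemma bracket_coord i j k : ring (bracket K n i j k).
Proof.
have sorted a b c : (a < b < c)%N -> (c < n)%N -> ring (volume (column a) (column b) (column c)).
  move=> abc cn; pose J := [set x : 'I_n | [|| x == a :> nat, x == b :> nat | x == c :> nat]].
  have [an bn] : (a < n)%N /\ (b < n)%N by split; lia.
  have J3 : #|J| = 3.
    have -> : J = [set Ordinal an; Ordinal bn; Ordinal cn].
      by apply/setP => x; rewrite !inE -!(inj_eq val_inj) /= orbA.
    rewrite setUC cardsU1 cards2 !inE -!(inj_eq val_inj) /=; lia.
  rewrite -volE -[vol _ _ _]/(bracket K n a b c) -(@plucker3 _ _ J) //; first exact: Coord_plucker.
  by move=> x; rewrite inE.
rewrite /bracket volE -(column_mod _ _ i) -(column_mod _ _ j) -(column_mod _ _ k).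
have := ltn_pmod k n0; have := ltn_pmod j n0; have := ltn_pmod i n0.
move: (i %% n)%N (j %% n)%N (k %% n)%N => {}i {}j {}k iN jN kN.
have swap a b c :
    ring (volume (column a) (column b) (column c)) -> ring (volume (column b) (column a) (column c)).
  by rewrite [volume (column b) _ _]volume_swap; apply: coordN.
have turn a b c :
    ring (volume (column a) (column b) (column c)) -> ring (volume (column c) (column a) (column b)).
  by rewrite [volume (column c) _ _]volume_rot.
have zero a b : ring (volume (column a) (column b) (column a)).
  by rewrite volume_rot volume_rot volume_aab; exact: coord0.
case: (ltngtP i j) => ij; last by rewrite ij volume_aab; exact: coord0.
- case: (ltngtP j k) => jk.
  + by apply: sorted; lia.
  + case: (ltngtP i k) => ik; last by rewrite ik.
    * by apply: (turn); apply: (turn); apply: swap; apply: sorted; lia.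
    * by apply: (turn); apply: (turn); apply: sorted; lia.
  + by rewrite jk volume_rot volume_aab; exact: coord0.
- case: (ltngtP j k) => jk.
  + case: (ltngtP i k) => ik; last by rewrite ik.
    * by apply: swap; apply: sorted; lia.
    * by apply: (turn); apply: sorted; lia.
  + by apply: (turn); apply: swap; apply: sorted; lia.
  + by rewrite jk volume_rot volume_aab; exact: coord0.
Qed.

(** The combinations have the shape of [cross_cross], so the vectors of trees stay in the span of
    the columns over the coordinate ring. *)
Inductive spanned : 'rV[M]_3 -> Prop :=
| Span_column i : spanned (column i)
| Span_comb x y u v : ring x -> ring y -> spanned u -> spanned v -> spanned (x *: u - y *: v).

Lemma volume_spanned u v w : spanned u -> spanned v -> spanned w -> ring (volume u v w).
Proof.
elim=> [i|x y u1 u2 rx ry _ IH1 _ IH2] sv sw; last first.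
  by rewrite volume_lin; apply: coordB; apply: Coord_mul => //; [apply: IH1|apply: IH2].
elim: sv => [j|x y u1 u2 rx ry _ IH1 _ IH2]; last first.
  rewrite volume_rot volume_lin -!(volume_rot (column i)).
  exact: (coordB (Coord_mul rx IH1) (Coord_mul ry IH2)).
elim: sw => [k|x y u1 u2 rx ry _ IH1 _ IH2]; last first.
  rewrite -volume_rot volume_lin !(volume_rot _ (column i)).
  exact: (coordB (Coord_mul rx IH1) (Coord_mul ry IH2)).
by have := bracket_coord i j k; rewrite /bracket volE.
Qed.

Lemma qeval_spanned s t o : spanned (qeval (fun j => column (j + s)) t o).
Proof.
elim: t o => [|a IHa b IHb c IHc d IHd] o /=; first exact: Span_column.
by rewrite cross_cross; apply: Span_comb; rewrite //; apply: volume_spanned.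
Qed.
End CoordinateRing.

(** * Webs are variables of reachable seeds *)

Section Webs.
Variable K : numFieldType.

Definition web (n s : nat) (a b c : qtree) : matrix_poly K 3 n :=
  let X j := column K n (j + s) in
  volume (qeval X a 0) (qeval X b (qsize a)) (qeval X c (qsize a + qsize b)).

Lemma web_rotation n s a b c : (3 <= n)%N ->
  rotation_hom K n (web n s a b c) = web n s.+1 a b c.
Proof.
move=> hn; rewrite /web volume_map !qeval_map; congr volume;
  by apply: qeval_ext => j _; rewrite rotation_column // addnS.
Qed.

Lemma web_mod n s a b c : web n (s + n) a b c = web n s a b c.
Proof.
by rewrite /web; congr volume; apply: qeval_ext => j _;
  rewrite addnA -column_mod modnDr column_mod.
Qed.

Lemma web_seed_variable_rotation n s s' a b c : (5 <= n)%N -> (s <= n)%N ->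
  seed_variable (rectangles_seed K 3 n) (tofrac (web n s a b c)) ->
  seed_variable (rectangles_seed K 3 n) (tofrac (web n s' a b c)).
Proof.
move=> n5 sn H; rewrite -web_mod.
(* Rotations only raise the shift, so [s'] is reached from [s] by going forward to [s' + n]. *)
have -> : (s' + n = s + (s' + n - s))%N by lia.
elim: (s' + n - s)%N => [|d IH]; first by rewrite addn0.
rewrite addnS -web_rotation; last by lia.
by apply: seed_variable_rotation IH; [lia | move=> ? ?; apply: rectangles_neq0; lia | lia].
Qed.

Theorem web_seed_variable n s a b c : (qsize a + qsize b + qsize c = n)%N ->
  seed_variable (rectangles_seed K 3 n) (tofrac (web n s a b c)).
Proof.
elim/ltn_ind: n s a b c => n IH s a b c En.
have n3 : (3 %| n)%N.
  by have := (qsize_mod3 a, qsize_mod3 b, qsize_mod3 c) => -[[? ?] ?]; lia.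
have n_ge3 : (3 <= n)%N by have := (qsize_gt0 a, qsize_gt0 b, qsize_gt0 c) => -[[? ?] ?]; lia.
have nz : forall S v, mutation_equivalent (rectangles_seed K 3 n) S -> variable S v != 0.
  by move=> S v; apply: rectangles_neq0.
have [leaves|] := boolP (all qleaf [:: a; b; c]).
  have {}En : n = 3.
    by case: a b c leaves En => // -[] // -[] //.
  exists (rectangles_seed K 3 n); first exact: Mut_refl.
  exists None.
  rewrite -[variable _ _]/(tofrac (plucker K 3 (@rect_columns 3 n None))).
  rewrite plucker_rect // /rect_bracket /= En; congr tofrac.
  have -> : web 3 s a b c = bracket K 3 s s.+1 s.+2.
    by case: a b c leaves => // -[] // -[] // _; rewrite /web /bracket volE.
  elim: s => [//|s IHs].
  by rewrite -[s.+3]addn3 bracket_mod -bracket_rot.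
move=> nl.
have [|k [s' [ss ks Es Ev]]] := @contract_forest (matrix_poly K 3 n) [:: a; b; c] _ nl.
  by do !split; exact: qtree_contractible.
case: s' ss ks Es Ev => [|a' [|b' [|c' [|]]]] // _ ks Es Ev.
move: ks Es; rewrite /qsizes /= addn0 => ks Es.
have n6 : (6 <= n)%N by have := (qsize_gt0 a', qsize_gt0 b', qsize_gt0 c') => -[[? ?] ?]; lia.
(* With the shift [n - k] the leaf [k], where the contracted node begins, is at column [n], that is
   at column 0; likewise [n - 3 - k] puts the contracted leaf at column 0 of the smaller web. *)
apply: (@web_seed_variable_rotation n (n - k)); try lia.
suff -> : web n (n - k) a b c = promotion_hom K n (web (n - 3) (n - 3 - k) a' b' c').
  apply: seed_variable_promotion => //.
  by apply: IH; lia.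
have E j : (j < n - 3)%N ->
    contract (fun j => column K n (j + (n - k))) k j =
    map_mx (promotion_hom K n) (column K (n - 3) (j + (n - 3 - k))).
  move=> lj; rewrite -(column_mod K (n - 3)) substitution_column ?ltn_pmod; try lia.
  rewrite /contract /promoted_column; case: (ltngtP j k) => jk.
  - rewrite modn_small; last by lia.
    by rewrite ifF; [congr column; lia | lia].
  - have -> : (j + (n - 3 - k) = (j - k) + (n - 3))%N by lia.
    rewrite modnDr modn_small; last by lia.
    rewrite ifF; last by lia.
    have -> : (j + 3 + (n - k) = (j - k + 3) + n)%N by lia.
    by rewrite -column_mod modnDr column_mod.
  - have -> : (j + (n - 3 - k) = n - 3)%N by lia.
    rewrite modnn /= /crossing.
    have Ek i : column K n (k + i + (n - k)) = column K n i.
      have -> : (k + i + (n - k) = i + n)%N by lia.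
      by rewrite -column_mod modnDr column_mod.
    by rewrite -(Ek 0%N) -(Ek 1%N) -(Ek 2%N) -(Ek 3%N) addn0 addn1 addn2 addn3.
rewrite /web volume_map !qeval_map.
have [/= -> -> ->] := Ev (fun j => column K n (j + (n - k))) 0%N.
by rewrite !add0n; congr volume; apply: qeval_ext => j lj; rewrite E //; lia.
Qed.
End Webs.

(** * Subtrees of a tree web *)

Section Subtrees.
Local Open Scope nat_scope.
Variables (n : nat) (D : tensor_diagram n) (n0 : 0 < n).
Local Notation V := (vertex D).
Local Notation H := (edge D * bool)%type.
Local Notation rot := (rotation D).
Local Notation hv := (@half_edge_at n D).
Local Notation leaf_index := (leaf_index n0).
Local Notation face_dart := (face_dart D n0).
Implicit Types (h g : H) (p q : seq H) (ws : seq (seq H)).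

Hypotheses (conn : connected D) (plan : planar D).
Hypothesis acyclic : forall c, ~~ @graph_cycle n D c.
Hypothesis deg1 : forall i : 'I_n, degree (inl i : V) = 1.
Hypothesis black : black_boundary D.

Definition leaf (s : nat) : V := inl (leaf_index s).

Lemma leaf_mod s s' : s = s' %[mod n] -> leaf s = leaf s'.
Proof. by move=> E; congr inl; apply: val_inj. Qed.

(** Faces determine the labels only modulo [n]; the distinct walks are kept along to bound the
    number of leaves. *)
Definition leaf_walks g ws s k : Prop :=
  [/\ [seq walk_end g q | q <- ws] = [seq leaf (s + j) | j <- iota 0 k], uniq ws
    & all (path (@reduced n D) g) ws].

(* The part of the tree whose output goes along h has the k leaves
   s, ..., s + k - 1: the faces on the two sides of h are those of the arcs
   before and after these leaves. *)
Definition subtree h k s : Prop :=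
  [/\ same_face (opposite (inl h : dart D)) (face_dart s),
      same_face (inl h) (face_dart (s + k))
    & exists ws, leaf_walks (flip h) ws s k].

Lemma leaf_walks_mod g ws s s' k : s = s' %[mod n] -> leaf_walks g ws s k -> leaf_walks g ws s' k.
Proof.
move=> E [Ew u p]; split=> //; rewrite Ew; apply: eq_map => j; apply: leaf_mod.
by apply/eqP; rewrite eqn_modDr; apply/eqP.
Qed.

Lemma subtree_mod h k s s' : s = s' %[mod n] -> subtree h k s -> subtree h k s'.
Proof.
move=> E [f1 f2 [ws W]]; split; last by exists ws; apply: leaf_walks_mod W.
- by rewrite -(face_dart_mod D n0 E).
- rewrite -(@face_dart_mod n D n0 (s + k) (s' + k)) //.
  by apply/eqP; rewrite eqn_modDr; apply/eqP.
Qed.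

Lemma opposite_flip h : opposite (inl h : dart D) = inl (flip h).
Proof. by case: h. Qed.

(** Consecutive branches border a common face, and its only arc lies between the last leaf of the
    first branch and the first leaf of the second. *)
Lemma subtree_adjacent g1 g2 k1 k2 s1 s2 : rot (inl g1) = inl g2 ->
  subtree (flip g1) k1 s1 -> subtree (flip g2) k2 s2 -> s2 = s1 + k1 %[mod n].
Proof.
move=> E [_ f1 _] [f2 _ _]; apply/esym; apply: (face_dart_inj (n0 := n0)) => //.
rewrite same_face_sym; apply: same_face_trans f1.
rewrite same_face_sym; apply: (same_face_trans (same_face_next _)).
by rewrite opposite_flip flipK E; rewrite opposite_flip flipK in f2.
Qed.

Lemma subtree_join h g1 g2 k1 k2 s : rot (inl h) = inl g1 -> rot (inl g1) = inl g2 ->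
  subtree (flip g1) k1 s -> subtree (flip g2) k2 (s + k1) -> subtree h (k1 + k2) s.
Proof.
move=> E1 E2 [f1 _ [ws1 [W1 u1 p1]]] [_ f2 [ws2 [W2 u2 p2]]].
rewrite !flipK in f1 f2 W1 W2 p1 p2.
have E3 : rot (inl g2) = inl h by rewrite -E2 -E1 rot3.
rewrite !opposite_flip flipK in f1.
split.
- apply: same_face_trans f1; rewrite -E1.
  by have := same_face_next (opposite (inl h : dart D)); rewrite oppositeK.
- rewrite addnA; apply: same_face_trans f2; rewrite same_face_sym.
  by apply: (same_face_trans (same_face_next _)); rewrite opposite_flip flipK E3 same_face_refl.
- have r1 := reduced_rot deg1 E1.
  have r2 : reduced (flip h) g2 by apply: reduced_rot2; rewrite ?E1.
  exists ([seq g1 :: q | q <- ws1] ++ [seq g2 :: q | q <- ws2]); split.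
  + rewrite map_cat -!map_comp iotaD map_cat add0n -[X in iota X k2]addn0 iotaDl -map_comp.
    congr (_ ++ _); first by rewrite -W1; apply: eq_map.
    rewrite -[RHS]/(map (fun j => leaf (s + (k1 + j))) _).
    by under [RHS]eq_map do rewrite addnA; rewrite -W2; apply: eq_map.
  + rewrite cat_uniq !map_inj_uniq ?u1 ?u2 ?andbT /=; try by move=> a b [].
    apply/hasPn => w /mapP[q _ ->]; apply/mapP => -[q' _ [Eg _]].
    by have := rot_neq deg1 (inl g1); rewrite E2 Eg eqxx.
  + rewrite all_cat !all_map; apply/andP; split.
      by apply: sub_all p1 => q qp /=; rewrite r1.
    by apply: sub_all p2 => q qp /=; rewrite r2.
Qed.

Lemma subtree_leaf h i : hv h = inl i -> subtree h 1 i.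
Proof.
move=> hi; have [E1 E2] := rot_boundary deg1 hi; split.
- apply: (same_face_trans (same_face_next _)); rewrite oppositeK E1.
  by rewrite /face_dart leaf_index_val same_face_refl.
- by rewrite addn1; apply: same_face_boundary.
- exists [:: [::]]; split=> //=.
  by rewrite /walk_end /= flipK hi /leaf addn0 leaf_index_val.
Qed.

(* More than n leaves would give two walks from the root to the same leaf. *)
Lemma subtree_total (r : internal D) h0 h1 h2 k0 k1 k2 s : hv h0 = inr r ->
  rot (inl h0) = inl h1 -> rot (inl h1) = inl h2 ->
  subtree (flip h0) k0 s -> subtree (flip h1) k1 (s + k0) -> subtree (flip h2) k2 (s + k0 + k1) ->
  0 < k0 -> k0 + k1 + k2 = n.
Proof.
move=> hr E0 E1 S0 S1 S2 k0_gt0.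
have E2 : rot (inl h2) = inl h0 by rewrite -E1 -E0 rot3.
(* A full turn around the root leads back to the first label modulo [n]. *)
have dvd : n %| k0 + k1 + k2.
  have := subtree_adjacent E2 S2 S0; rewrite -!addnA -{1}[s]addn0 => /eqP.
  by rewrite eqn_modDl mod0n eq_sym.
case: S0 S1 S2 => _ _ [ws0 [W0 u0 p0]] [_ _ [ws1 [W1 u1 p1]]] [_ _ [ws2 [W2 u2 p2]]].
rewrite !flipK in W0 W1 W2 p0 p1 p2.
apply/eqP; rewrite eqn_leq andbC dvdn_leq ?addn_gt0 ?k0_gt0 //= leqNgt; apply/negP => nk.
pose W := [seq h0 :: q | q <- ws0] ++ [seq h1 :: q | q <- ws1] ++ [seq h2 :: q | q <- ws2].
pose endpoint w := if w is g :: q then walk_end g q else leaf 0.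
have EW : [seq endpoint w | w <- W] = [seq leaf (s + j) | j <- iota 0 (k0 + k1 + k2)].
  rewrite !map_cat -!map_comp -addnA iotaD map_cat add0n.
  congr (_ ++ _); first by rewrite -W0; apply: eq_map.
  rewrite iotaD map_cat; congr (_ ++ _).
    rewrite -[X in iota X k1]addn0 iotaDl -map_comp.
    rewrite -[RHS]/(map (fun j => leaf (s + (k0 + j))) _).
    by under [RHS]eq_map do rewrite addnA; rewrite -W1; apply: eq_map.
  rewrite -[X in iota X k2]addn0 iotaDl -map_comp.
  rewrite -[RHS]/(map (fun j => leaf (s + (k0 + k1 + j))) _).
  by under [RHS]eq_map do rewrite !addnA; rewrite -W2; apply: eq_map.
have sW : size W = k0 + k1 + k2 by rewrite -(size_map endpoint) EW size_map size_iota.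
have hv1 : hv h1 = inr r by have := vertex_rot (inl h0 : dart D); rewrite E0 -hr.
have hv2 : hv h2 = inr r by have := vertex_rot (inl h1 : dart D); rewrite E1 -hv1.
have Wp w : w \in W -> exists g q, [/\ w = g :: q, path (@reduced n D) g q & hv g = inr r].
  rewrite !mem_cat => /or3P[] /mapP[q qin ->].
  - by exists h0, q; split=> //; exact: (allP p0).
  - by exists h1, q; split=> //; exact: (allP p1).
  - by exists h2, q; split=> //; exact: (allP p2).
have h01 : h1 != h0 by have := rot_neq deg1 (inl h0); rewrite E0.
have h12 : h2 != h1 by have := rot_neq deg1 (inl h1); rewrite E1.
have h02 : h2 != h0 by have := rot2_neq deg1 (inl h0); rewrite E0 E1.
have uW : uniq W.
  have disj g g' (l l' : seq (seq H)) : g' != g ->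
      ~~ has [in [seq g :: q | q <- l]] [seq g' :: q | q <- l'].
    move=> ng; apply/hasPn => w /mapP[q _ ->]; apply/mapP => -[q' _ [Eg _]].
    by rewrite Eg eqxx in ng.
  rewrite !cat_uniq !map_inj_uniq ?u0 ?u1 ?u2 ?andbT /=; try by move=> a b [].
  by rewrite has_cat negb_or !disj.
have nth_end j : j < k0 + k1 + k2 -> endpoint (nth [::] W j) = leaf (s + j).
  move=> jk; rewrite -(nth_map [::] (leaf 0)) ?sW // EW (nth_map 0) ?size_iota //.
  by rewrite nth_iota.
have k_gt0 : 0 < k0 + k1 + k2 by rewrite !addn_gt0 k0_gt0.
have [g [q [Ew wp hg]]] := Wp (nth [::] W 0) (mem_nth _ (eq_ind_r (fun m => 0 < m) k_gt0 sW)).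
have [g' [q' [Ew' wp' hg']]] := Wp (nth [::] W n) (mem_nth _ (eq_ind_r (fun m => n < m) nk sW)).
have : g :: q = g' :: q'.
  apply: (walk_unique acyclic wp wp'); first by rewrite hg hg'.
  have := nth_end 0 k_gt0; have := nth_end n nk; rewrite Ew Ew' /= => -> ->.
  by apply: leaf_mod; rewrite addn0 modnDr.
rewrite -Ew -Ew' => /eqP; rewrite nth_uniq ?sW // => /eqP E.
by move: n0; rewrite -E.
Qed.

Variable K : numFieldType.
Local Notation column := (column K n).

Definition vector_subtree m h t s : Prop :=
  output K m (inl h : dart D) = qeval column t s /\ subtree h (qsize t) s.

Definition covector_subtree m h t1 t2 s : Prop :=
  output K m (inl h : dart D) = cross (qeval column t1 s) (qeval column t2 (s + qsize t1))
  /\ subtree h (qsize t1 + qsize t2) s.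

Lemma column_modE s s' : s = s' %[mod n] -> column s = column s'.
Proof. by move=> E; rewrite -column_mod E column_mod. Qed.

Lemma qeval_mod t s s' : s = s' %[mod n] -> qeval column t s = qeval column t s'.
Proof.
move=> E; apply: qeval_ext => j _; apply: column_modE.
by apply/eqP; rewrite eqn_modDr; apply/eqP.
Qed.

Lemma internal_rot h v : hv h = inr v -> exists g1 g2,
  [/\ rot (inl h) = inl g1, rot (inl g1) = inl g2, hv g1 = inr v & hv g2 = inr v].
Proof.
move=> hhv; have v1 : vertex_of (rot (inl h)) = inr v by rewrite vertex_rot.
have [g1 [E1 hg1]] := rot_internal v1.
have v2 : vertex_of (rot (inl g1)) = inr v by rewrite vertex_rot.
by have [g2 [E2 hg2]] := rot_internal v2; exists g1, g2.
Qed.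

Lemma half_edge_color h : is_white (hv h) = h.2.
Proof.
case: h => e [] /=; first exact: white_endP.
by apply/negbTE; exact: black_endP.
Qed.

(** [h0 :: p] is the walk from the root down to [h]. Its length plus the remaining depth [m] stays
    at least [#|V|], so the recursion cannot run out before a leaf: the walk would have more than
    [#|V|] distinct vertices. The color [h.2] decides between covectors and vectors. *)
Lemma output_subtree m h0 p h : path (@reduced n D) h0 p -> last h0 p = flip h ->
  #|V| <= size (h0 :: p) + m ->
  if h.2 then exists t1 t2 s, covector_subtree m h t1 t2 s
  else exists t s, vector_subtree m h t s.
Proof.
elim: m p h => [|m IH] p h hp lp mV.
  have /card_uniqP := walk_uniq acyclic hp; rewrite size_rcons size_map => E.
  have := max_card (mem (rcons [seq hv i | i <- h0 :: p] (walk_end h0 p))).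
  by rewrite E; move: mV => /=; lia.
case Eh : (hv h) => [i|v].
  have -> : h.2 = false by apply/negbTE; rewrite -half_edge_color Eh; exact: black.
  exists QLeaf, i; split; last exact: subtree_leaf.
  by rewrite /= -[half_edge_vertex _ _ _]/(hv h) Eh columnE.
have [g1 [g2 [E1 E2 hg1 hg2]]] := internal_rot Eh.
have c1 : g1.2 = h.2 by rewrite -!half_edge_color hg1 Eh.
have c2 : g2.2 = h.2 by rewrite -!half_edge_color hg2 Eh.
have Eout : output K m.+1 (inl h : dart D) =
    cross (output K m (inl (flip g1) : dart D)) (output K m (inl (flip g2) : dart D)).
  by rewrite [LHS]/= -[half_edge_vertex _ _ _]/(hv h) Eh E1 E2 !opposite_flip.
have step g : reduced (flip h) g -> g.2 = h.2 ->
    if ~~ h.2 then exists t1 t2 s, covector_subtree m (flip g) t1 t2 s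
    else exists t s, vector_subtree m (flip g) t s.
  move=> r cg; have := IH (rcons p g) (flip g).
  rewrite rcons_path hp lp r last_rcons flipK /= size_rcons cg; apply=> //.
  by move: mV => /=; lia.
have := step g2 (reduced_rot2 deg1 _) c2; rewrite E1 => /(_ E2).
have := step g1 (reduced_rot deg1 E1) c1.
case: (h.2) => /=.
- move=> [t1 [s [o1 S1]]] [t2 [s2 [o2 S2]]].
  have E := subtree_adjacent E2 S1 S2.
  exists t1, t2, s; split.
    by rewrite Eout; exact: (congr2 _ o1 (etrans o2 (qeval_mod t2 E))).
  by apply: (subtree_join E1 E2 S1); apply: subtree_mod S2.
- move=> [a [b [s [o1 S1]]]] [c [d [s2 [o2 S2]]]].
  have E := subtree_adjacent E2 S1 S2; rewrite addnA in E.
  exists (QNode a b c d), s; split.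
    have Ed : qeval column d (s2 + qsize c) = qeval column d (s + qsize a + qsize b + qsize c).
      by apply: qeval_mod; apply/eqP; rewrite eqn_modDr; apply/eqP.
    by rewrite Eout; exact: (congr2 _ o1 (etrans o2 (congr2 _ (qeval_mod c E) Ed))).
  rewrite /= -addnA; apply: (subtree_join E1 E2 S1); apply: subtree_mod S2.
  by rewrite addnA.
Qed.

Lemma webE s a b c : web K n s a b c =
  volume (qeval column a s) (qeval column b (s + qsize a)) (qeval column c (s + qsize a + qsize b)).
Proof.
rewrite /web; congr volume; apply: qeval_ext => j _; apply: column_modE; congr (_ %% _); lia.
Qed.

Theorem web_invariant_qtrees (r : internal D) : exists a b c s,
  qsize a + qsize b + qsize c = n /\ web_invariant K r = web K n s a b c.
Proof.
rewrite /web_invariant; case: pickP => [x /eqP Ex|nox]; last first.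
  have /card_gt0P[h] : 0 < #|[set h | hv h == inr r]| by rewrite trivalentP.
  by rewrite inE; have := nox (inl h); rewrite /= => ->.
have [h0 [Ex0 hh0]] := rot_internal Ex; subst x.
have [h1 [h2 [E0 E1 hh1 hh2]]] := internal_rot hh0.
have c1 : h1.2 = h0.2 by rewrite -!half_edge_color hh1 hh0.
have c2 : h2.2 = h0.2 by rewrite -!half_edge_color hh2 hh0.
rewrite E0 E1 !opposite_flip.
have sub g : g.2 = h0.2 -> hv g = inr r ->
    if ~~ h0.2 then exists t1 t2 s, covector_subtree #|V| (flip g) t1 t2 s
    else exists t s, vector_subtree #|V| (flip g) t s.
  move=> cg hg; rewrite -cg -/((flip g).2).
  by apply: (@output_subtree _ g [::]); rewrite //= ?flipK //; lia.
have := sub h2 c2 hh2; have := sub h1 c1 hh1; have := sub h0 erefl hh0.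
have E2 : rot (inl h2) = inl h0 by rewrite -E1 -E0 rot3.
case: (h0.2) => /=.
- move=> [a [s [o0 S0]]] [b [s1 [o1 S1]]] [c [s2 [o2 S2]]].
  have F1 := subtree_adjacent E0 S0 S1; have {}S1 := subtree_mod F1 S1.
  have F2 := subtree_adjacent E1 S1 S2; have {}S2 := subtree_mod F2 S2.
  exists a, b, c, s; split; first exact: (subtree_total hh0 E0 E1 S0 S1 S2 (qsize_gt0 a)).
  by rewrite webE o0 (etrans o1 (qeval_mod b F1)) (etrans o2 (qeval_mod c F2)).
(* At a black root the volume of [a x b], [c x d], [e x f] equals that of [a], [b],
   [(c x d) x (e x f)]: the last two branches merge into one node, as if the root were moved to its
   first white neighbour. *)
- move=> [a [b [s [o0 S0]]]] [c [d [s1 [o1 S1]]]] [e [f [s2 [o2 S2]]]].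
  have F1 := subtree_adjacent E0 S0 S1; have {}S1 := subtree_mod F1 S1.
  have F2 := subtree_adjacent E1 S1 S2; have {}S2 := subtree_mod F2 S2.
  exists a, b, (QNode c d e f), s; split.
    have k0_gt0 : 0 < qsize a + qsize b by rewrite addn_gt0 qsize_gt0.
    by rewrite -[RHS](subtree_total hh0 E0 E1 S0 S1 S2 k0_gt0) /= !addnA.
  have mod k i j : i = j %[mod n] -> i + k = j + k %[mod n].
    by move=> E; apply/eqP; rewrite eqn_modDr; apply/eqP.
  rewrite webE o0 volume_cross.
  have -> := etrans o1 (congr2 _ (qeval_mod c F1) (qeval_mod d (mod (qsize c) _ _ F1))).
  have -> := etrans o2 (congr2 _ (qeval_mod e F2) (qeval_mod f (mod (qsize e) _ _ F2))).
  by rewrite /= !addnA.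
Qed.
End Subtrees.

Theorem theorem4p11 (R : realType) (n : nat) (hn : (3 <= n)%N)
    (D : tensor_diagram n) (hD : Gr3_tree_web D) (r : internal D) :
  in_coordinate_ring (web_invariant R[i] r) /\
  (cluster_variable (rectangles_seed R[i] 3 n) (tofrac (web_invariant R[i] r)) \/
   frozen_variable (rectangles_seed R[i] 3 n) (tofrac (web_invariant R[i] r))).
Proof.
have n0 : (0 < n)%N by exact: leq_trans hn.
case: hD => black [plan conn acyclic deg1].
have [a [b [c [s [En ->]]]]] :=
  web_invariant_qtrees n0 conn plan acyclic deg1 black R[i] r.
split; last by apply: seed_variableP; apply: web_seed_variable.
by apply: volume_spanned => //; apply: qeval_spanned.
Qed.
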